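(* Let $\mathcal{H},\mathcal{K}$ be finite-dimensional Hilbert spaces with $\dim(\mathcal{K})\ge\dim(\mathcal{H})$, let $\rho,\sigma$ be density matrices on $\mathcal{H}$, let $r>1$ be real, and let $k:=S(\rho\|\sigma)$. Let $|\psi\rangle$ be a purification of $\rho$ in $\mathcal{H}\otimes\mathcal{K}$. Then there exist pure states $|\phi\rangle,|\theta\rangle\in\mathcal{H}\otimes\mathcal{K}$ and $|\zeta\rangle\in\mathcal{H}\otimes\mathcal{K}\otimes\mathbb{C}^2$ (depending on $r$) such that $|\zeta\rangle$ is a purification of $\sigma$, $\| |\psi\rangle\langle\psi|-|\phi\rangle\langle\phi| \|_{\mathrm{tr}}\le 2/\sqrt{r}$, and \[ |\zeta\rangle=\sqrt{\frac{r-1}{r2^{rk'}}}\,|\phi\rangle|1\rangle+\sqrt{1-\frac{r-1}{r2^{rk'}}}\,|\theta\rangle|0\rangle,\qquad k':=k+4\sqrt{k+2}+2\log(k+2)+5 . \]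
   Context: Relative entropy: $S(\rho\|\sigma):=\mathrm{Tr}\,\rho(\log\rho-\log\sigma)$; all logarithms are to base 2. Trace distance: $\|\rho-\sigma\|_{\mathrm{tr}}:=\mathrm{Tr}\sqrt{(\rho-\sigma)^2}$. A purification of a density matrix $\sigma$ on $\mathcal{H}$ is a pure state on $\mathcal{H}\otimes\mathcal{L}$ whose partial trace over $\mathcal{L}$ equals $\sigma$. *)

(* Defs.v *)
From HB Require Import structures.
From mathcomp Require Import all_boot all_order all_algebra.
From mathcomp Require Import complex.
From mathcomp Require Import reals exp.
Set Implicit Arguments. Unset Strict Implicit. Unset Printing Implicit Defensive.
Import Order.TTheory GRing.Theory Num.Theory.
Local Open Scope ring_scope.
Local Open Scope complex_scope.

Section QInfo.
Variable R : realType.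
Local Notation C := R[i].

Definition adj m n (A : 'M[C]_(m, n)) : 'M[C]_(n, m) := map_mx conjc A^T.

(* Functional calculus for normal matrices through the library's spectral
   decomposition A = P^-1 diag(d) P  (spectral.v: orthomx_spectralP). *)
Definition mxfun n (f : C -> C) (A : 'M[C]_n) : 'M[C]_n :=
  invmx (spectralmx A) *m diag_mx (map_mx f (spectral_diag A)) *m spectralmx A.

Definition sqrtm n (A : 'M[C]_n) : 'M[C]_n := mxfun sqrtC A.

Definition log2 (x : R) : R := ln x / ln 2.

(* matrix logarithm to base 2 (value on the kernel is irrelevant below) *)
Definition logm n (A : 'M[C]_n) : 'M[C]_n :=
  mxfun (fun z : C => (log2 (complex.Re z))%:C) A.

Definition density n (A : 'M[C]_n) : Prop :=
  [/\ adj A = A,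
      forall v : 'cV[C]_n, 0 <= (adj v *m A *m v) 0 0
    & \tr A = 1].

(* support of rho contained in the support of sigma (finiteness of S(rho||sigma)) *)
Definition supp_le n (rho sigma : 'M[C]_n) : Prop :=
  forall v : 'cV[C]_n, sigma *m v = 0 -> rho *m v = 0.

(* relative entropy S(rho||sigma) = Tr rho (log rho - log sigma), base 2;
   only meaningful (finite) when supp rho <= supp sigma *)
Definition relent n (rho sigma : 'M[C]_n) : R :=
  complex.Re (\tr (rho *m (logm rho - logm sigma))).

Definition trnorm n (A : 'M[C]_n) : R := complex.Re (\tr (sqrtm (A *m A))).

Definition unit_vec n (v : 'cV[C]_n) : Prop := adj v *m v = 1%:M.

Definition ketbra n (v : 'cV[C]_n) : 'M[C]_n := v *m adj v.

(* tensor product of kets, u (x) v, indices ordered by mxvec_index *)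
Definition kron p q (u : 'cV[C]_p) (v : 'cV[C]_q) : 'cV[C]_(p * q) :=
  (mxvec (u *m v^T))^T.

Definition ptrace p q (A : 'M[C]_(p * q)) : 'M[C]_p :=
  \matrix_(i, j) \sum_(k < q) A (mxvec_index i k) (mxvec_index j k).

Definition ket0 : 'cV[C]_2 := delta_mx 0 0.
Definition ket1 : 'cV[C]_2 := delta_mx 1 0.

End QInfo.
Arguments ket0 {R}.
Arguments ket1 {R}.

(* Main.v *)
Require Import Defs.
From HB Require Import structures.
From mathcomp Require Import all_boot all_order all_algebra.
From mathcomp Require Import complex.
From mathcomp Require Import reals exp convex interval_inference.
From mathcomp Require Import boolp classical_sets topology normedtype derive.
From mathcomp Require Import ring lra.
Import Order.TTheory GRing.Theory Num.Theory.
Import numFieldNormedType.Exports.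
Local Open Scope ring_scope.
Local Open Scope complex_scope.
Set Implicit Arguments. Unset Strict Implicit. Unset Printing Implicit Defensive.

(* Purifications of [rho] and of states below [L sigma] are identified with
   matrices: [psi] becomes [X] with [X X^* = rho], and with [L = 2^(r k')] one
   wants a near-optimal overlap of [X] with some [B] such that [B B^* <= L sigma].
   The nearest such point is [B = (1 + M)^-1 X], where the Lagrange multiplier
   [M >= 0] minimises the dual functional
   [Tr rho (1 + M)^-1 + L Tr sigma M].  First-order conditions at the minimum
   give [B B^* <= L sigma], and [L <e|sigma|e> <= <e|rho|e>] for every
   eigenvector [e] of [M] outside its kernel.  Hence, with [P] the projector
   onto the range of [M], [L Tr P sigma <= Tr P rho], while [B] agrees with [X]
   on the kernel of [M], so that all the loss is bounded by [p = Tr P rho].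

   To bound [p] one compares [S(rho||sigma)] with the two-outcome measurement
   [P]: for every [c > 0] the Cauchy-Schwarz inequality gives
   [sum_(a, b) |<a|b>|^2 a^2 / (a + c b) >= p - c Tr P sigma] over the
   eigenvalues [a], [b] of [rho], [sigma], and summing over the dyadic values
   [c = 2, 4, ..., 2^N] approximates [S(rho||sigma)] on the left from below (up
   to an additive constant) and [p log L] on the right.  This gives
   [p log L <= S(rho||sigma) + 5 <= k'], that is [p <= 1 / r]. *)

(** * Complex matrices: squared moduli, adjoints, positivity and spectral decompositions *)

Section LinearAlgebra.
Variable R : realType.
Local Notation C := R[i].

Lemma ReD (x y : C) : complex.Re (x + y) = complex.Re x + complex.Re y.
Proof. by case: x y => [a b] [c d]. Qed.

Lemma ReN (x : C) : complex.Re (- x) = - complex.Re x.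
Proof. by case: x. Qed.

Lemma ReB (x y : C) : complex.Re (x - y) = complex.Re x - complex.Re y.
Proof. by rewrite ReD ReN. Qed.

Lemma Re_realM (a : R) (x : C) : complex.Re (a%:C * x) = a * complex.Re x.
Proof. by case: x => c d /=; rewrite mul0r subr0. Qed.

Lemma Re_sum (I : Type) (s : seq I) (P : pred I) (F : I -> C) :
  complex.Re (\sum_(i <- s | P i) F i) = \sum_(i <- s | P i) complex.Re (F i).
Proof. by apply: (big_morph _ ReD). Qed.

Lemma Re_ge0 (x : C) : 0 <= x -> 0 <= complex.Re x.
Proof. by rewrite lecE => /andP[]. Qed.

Lemma ge0_ReE (x : C) : 0 <= x -> x = (complex.Re x)%:C.
Proof. by move=> /ger0_real /RRe_real. Qed.

Definition sqn (x : C) : R := complex.Re x ^+ 2 + complex.Im x ^+ 2.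

Lemma sqnE (x : C) : x * conjc x = (sqn x)%:C.
Proof.
case: x => a b; rewrite /sqn /= !expr2; apply/eqP.
by rewrite eq_complex /= mulrN opprK eqxx mulrN mulrC addNr eqxx.
Qed.

Lemma sqn_ge0 (x : C) : 0 <= sqn x.
Proof. by rewrite addr_ge0 ?sqr_ge0. Qed.

Lemma sqn_eq0 (x : C) : sqn x = 0 -> x = 0.
Proof.
case: x => a b /eqP; rewrite /sqn /= paddr_eq0 ?sqr_ge0 // !sqrf_eq0.
by move=> /andP[/eqP -> /eqP ->].
Qed.

Lemma sqn_conj (x : C) : sqn (conjc x) = sqn x.
Proof. by case: x => a b; rewrite /sqn /= sqrrN. Qed.

Lemma adjE m n (A : 'M[C]_(m, n)) i j : adj A i j = conjc (A j i).
Proof. by rewrite !mxE. Qed.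

Lemma adjK m n (A : 'M[C]_(m, n)) : adj (adj A) = A.
Proof. by apply/matrixP => i j; rewrite !adjE conjcK. Qed.

Lemma adjM m n p (A : 'M[C]_(m, n)) (B : 'M[C]_(n, p)) :
  adj (A *m B) = adj B *m adj A.
Proof. by rewrite /adj trmx_mul map_mxM. Qed.

Lemma adjD m n (A B : 'M[C]_(m, n)) : adj (A + B) = adj A + adj B.
Proof. by apply/matrixP => i j; rewrite !mxE rmorphD. Qed.

Lemma adjN m n (A : 'M[C]_(m, n)) : adj (- A) = - adj A.
Proof. by apply/matrixP => i j; rewrite !mxE rmorphN. Qed.

Lemma adjB m n (A B : 'M[C]_(m, n)) : adj (A - B) = adj A - adj B.
Proof. by rewrite adjD adjN. Qed.

Lemma adj_scale m n (a : R) (A : 'M[C]_(m, n)) : adj (a%:C *: A) = a%:C *: adj A.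
Proof. by apply/matrixP => i j; rewrite !mxE rmorphM /= oppr0. Qed.

Lemma tr_gram m n (A : 'M[C]_(m, n)) :
  \tr (A *m adj A) = (\sum_i \sum_j sqn (A i j))%:C.
Proof.
rewrite /mxtrace rmorph_sum; apply: eq_bigr => i _; rewrite mxE rmorph_sum.
by apply: eq_bigr => j _; rewrite adjE sqnE.
Qed.

Definition rdiag n (d : 'I_n -> R) : 'M[C]_n := diag_mx (\row_i (d i)%:C).

Lemma rdiagE n (d : 'I_n -> R) i j : rdiag d i j = (d i)%:C *+ (i == j).
Proof. by rewrite !mxE. Qed.

Lemma rdiagM n (d e : 'I_n -> R) :
  rdiag d *m rdiag e = rdiag (fun i => d i * e i).
Proof.
rewrite /rdiag mulmx_diag; congr diag_mx.
by apply/rowP => i; rewrite !mxE rmorphM.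
Qed.

Lemma adj_rdiag n (d : 'I_n -> R) : adj (rdiag d) = rdiag d.
Proof.
apply/matrixP => i j; rewrite adjE !rdiagE eq_sym; case: eqP => [->|_] //=.
- by rewrite oppr0.
- by rewrite oppr0.
Qed.

Lemma mul_rdiagE m n (d : 'I_n -> R) (A : 'M[C]_(n, m)) i j :
  (rdiag d *m A) i j = (d i)%:C * A i j.
Proof. by rewrite mul_diag_mx !mxE. Qed.

Lemma tr_rdiagM n (d : 'I_n -> R) (A : 'M[C]_n) :
  \tr (rdiag d *m A) = \sum_i (d i)%:C * A i i.
Proof. by rewrite /mxtrace; apply: eq_bigr => i _; rewrite mul_rdiagE. Qed.

Lemma eq_rdiag n (d e : 'I_n -> R) : d =1 e -> rdiag d = rdiag e.
Proof. by move=> de; congr diag_mx; apply/rowP => i; rewrite !mxE de. Qed.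

Lemma rdiag1 n : rdiag (fun _ : 'I_n => 1) = 1%:M.
Proof. by apply/matrixP => i j; rewrite rdiagE mxE. Qed.

Lemma rdiagD n (d e : 'I_n -> R) :
  rdiag d + rdiag e = rdiag (fun i => d i + e i).
Proof.
by apply/matrixP => i j; rewrite mxE !rdiagE -mulrnDl -rmorphD.
Qed.

Lemma rdiagZ n (a : R) (d : 'I_n -> R) :
  a%:C *: rdiag d = rdiag (fun i => a * d i).
Proof.
by apply/matrixP => i j; rewrite [LHS]mxE !rdiagE mulrnAr -rmorphM.
Qed.

Definition psd n (A : 'M[C]_n) : Prop :=
  adj A = A /\ forall v : 'cV[C]_n, 0 <= (adj v *m A *m v) 0 0.

Lemma psd_gram m n (A : 'M[C]_(m, n)) : psd (A *m adj A).
Proof.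
split=> [|v]; first by rewrite adjM adjK.
rewrite mulmxA -mulmxA -[adj v *m A]adjK adjM adjK mxE.
apply: sumr_ge0 => i _; rewrite adjE mulrC sqnE ler0c; exact: sqn_ge0.
Qed.

Lemma psd_cong m n (B : 'M[C]_(m, n)) (A : 'M[C]_n) :
  psd A -> psd (B *m A *m adj B).
Proof.
move=> [hA pA]; split=> [|v]; first by rewrite !adjM adjK hA mulmxA.
by have := pA (adj B *m v); rewrite adjM adjK !mulmxA.
Qed.

Lemma psdD n (A B : 'M[C]_n) : psd A -> psd B -> psd (A + B).
Proof.
move=> [hA pA] [hB pB]; split=> [|v]; first by rewrite adjD hA hB.
by rewrite mulmxDr mulmxDl mxE addr_ge0.
Qed.

Lemma psdZ n (a : R) (A : 'M[C]_n) : 0 <= a -> psd A -> psd (a%:C *: A).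
Proof.
move=> a0 [hA pA]; split=> [|v]; first by rewrite adj_scale hA.
by rewrite -scalemxAr -scalemxAl mxE mulr_ge0 ?ler0c.
Qed.

Lemma psd_diag_ge0 n (A : 'M[C]_n) i : psd A -> 0 <= A i i.
Proof.
move=> [_ /(_ (delta_mx i 0))]; suff -> : adj (delta_mx i 0 : 'cV[C]_n) = delta_mx 0 i.
  by rewrite -rowE -colE !mxE.
by apply/matrixP => k l; rewrite !mxE andbC rmorph_nat.
Qed.

Lemma psd_tr_ge0 n (A : 'M[C]_n) : psd A -> 0 <= \tr A.
Proof. by move=> pA; apply: sumr_ge0 => i _; apply: psd_diag_ge0. Qed.

Lemma psd_rdiag n (d : 'I_n -> R) : (forall i, 0 <= d i) -> psd (rdiag d).
Proof.
move=> d0; split=> [|v]; first exact: adj_rdiag.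
rewrite -mulmxA mxE; apply: sumr_ge0 => i _.
rewrite mul_rdiagE adjE mulrCA [conjc _ * _]mulrC sqnE -rmorphM ler0c.
by rewrite mulr_ge0 ?sqn_ge0.
Qed.

Definition unitary n (U : 'M[C]_n) := U *m adj U = 1%:M /\ adj U *m U = 1%:M.

(** The adjoint stands on the left, as in the decomposition by [spectralmx]. For a fixed unitary
    [U], sums and products act entrywise on [d], so identities between functions of one matrix
    become scalar identities. *)
Definition spec n (U : 'M[C]_n) (d : 'I_n -> R) := adj U *m rdiag d *m U.

Lemma adj_spec n (U : 'M[C]_n) d : adj (spec U d) = spec U d.
Proof. by rewrite !adjM adjK adj_rdiag mulmxA. Qed.

Lemma psd_spec n (U : 'M[C]_n) d : (forall i, 0 <= d i) -> psd (spec U d).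
Proof. by move=> /psd_rdiag /(psd_cong (adj U)); rewrite adjK. Qed.

Lemma specM n (U : 'M[C]_n) d e : unitary U ->
  spec U d *m spec U e = spec U (fun i => d i * e i).
Proof.
move=> [UU _]; rewrite /spec !mulmxA -[_ *m U *m adj U]mulmxA UU mulmx1.
by rewrite -[_ *m rdiag e]mulmxA rdiagM.
Qed.

Lemma specD n (U : 'M[C]_n) d e :
  spec U d + spec U e = spec U (fun i => d i + e i).
Proof. by rewrite /spec -mulmxDl -mulmxDr rdiagD. Qed.

Lemma specZ n (U : 'M[C]_n) (a : R) d :
  a%:C *: spec U d = spec U (fun i => a * d i).
Proof. by rewrite /spec scalemxAl scalemxAr rdiagZ. Qed.

Lemma specB n (U : 'M[C]_n) d e :
  spec U d - spec U e = spec U (fun i => d i - e i).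
Proof.
apply: (@addIr _ (spec U e)); rewrite subrK specD; congr (_ *m _ *m _).
by congr diag_mx; apply/rowP => i; rewrite !mxE subrK.
Qed.

Lemma eq_spec n (U : 'M[C]_n) d e : d =1 e -> spec U d = spec U e.
Proof. by move=> /eq_rdiag de; rewrite /spec de. Qed.

Lemma spec1 n (U : 'M[C]_n) : unitary U -> spec U (fun=> 1) = 1%:M.
Proof. by move=> [_ UU]; rewrite /spec rdiag1 mulmx1. Qed.

Lemma tr_specM n (U A : 'M[C]_n) d :
  \tr (spec U d *m A) = \sum_i (d i)%:C * (U *m A *m adj U) i i.
Proof. by rewrite -tr_rdiagM /spec -!mulmxA mxtrace_mulC !mulmxA. Qed.

Lemma tr_spec n (U : 'M[C]_n) d : unitary U -> \tr (spec U d) = (\sum_i d i)%:C.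
Proof.
move=> [UU _]; rewrite -[spec U d]mulmx1 tr_specM mulmx1 UU rmorph_sum.
by apply: eq_bigr => i _; rewrite mxE eqxx mulr1.
Qed.

Lemma adj_tstar m n (A : 'M[C]_(m, n)) : map_mx (@Num.conj C) A^T = adj A.
Proof. by []. Qed.

Lemma spectralmx_unitary n (A : 'M[C]_n) : unitary (spectralmx A).
Proof.
have /unitarymxP UU := spectral_unitarymx A; rewrite adj_tstar in UU.
by split=> //; apply: mulmx1C.
Qed.

Lemma invmx_spectralmx n (A : 'M[C]_n) : invmx (spectralmx A) = adj (spectralmx A).
Proof. exact: invmx_unitary (spectral_unitarymx A). Qed.

Definition eigenv n (A : 'M[C]_n) i : R := complex.Re (spectral_diag A 0 i).

Lemma hermitian_spectral n (A : 'M[C]_n) : adj A = A ->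
  A = spec (spectralmx A) (eigenv A) /\
  forall i, spectral_diag A 0 i = (eigenv A i)%:C.
Proof.
move=> hA; have hs : A \is hermsymmx.
  by rewrite qualifE /= expr0 scale1r; apply/eqP; rewrite adj_tstar hA.
have /orthomx_spectralP := hermitian_normalmx hs.
rewrite invmx_spectralmx => eA.
have rd i : spectral_diag A 0 i = (eigenv A i)%:C.
  have /mxOverP/(_ 0 i) := hermitian_spectral_diag_real hs.
  by move=> /RRe_real <-.
split; last exact: rd.
rewrite [LHS]eA /spec /rdiag; congr (_ *m diag_mx _ *m _).
by apply/rowP => i; rewrite mxE rd.
Qed.

Lemma mxfun_spec n (f : C -> C) (g : R -> R) (A : 'M[C]_n) : adj A = A ->
  (forall i, f (eigenv A i)%:C = (g (eigenv A i))%:C) ->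
  mxfun f A = spec (spectralmx A) (fun i => g (eigenv A i)).
Proof.
move=> /hermitian_spectral[_ rd] fg; rewrite /mxfun invmx_spectralmx /spec /rdiag.
by congr (_ *m diag_mx _ *m _); apply/rowP => i; rewrite !mxE rd fg.
Qed.

Lemma spec_diag n (U : 'M[C]_n) d i : unitary U ->
  (U *m spec U d *m adj U) i i = (d i)%:C.
Proof.
move=> [UU _]; rewrite /spec !mulmxA UU mul1mx -mulmxA UU mulmx1.
by rewrite rdiagE eqxx.
Qed.

Lemma spec_inj n (U : 'M[C]_n) d e : unitary U -> spec U d = spec U e -> d =1 e.
Proof.
by move=> uU de i; apply: (@complexI R); rewrite -!(spec_diag _ _ uU) de.
Qed.

Lemma eigenv_ge0 n (A : 'M[C]_n) i : psd A -> 0 <= eigenv A i.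
Proof.
move=> pA; have [eA _] := hermitian_spectral pA.1.
have := psd_diag_ge0 i (psd_cong (spectralmx A) pA).
by rewrite {2}eA spec_diag ?ler0c //; exact: spectralmx_unitary.
Qed.

Lemma psd_factor n (A : 'M[C]_n) : psd A -> exists B : 'M[C]_n, A = B *m adj B.
Proof.
move=> pA; have [eA _] := hermitian_spectral pA.1.
exists (adj (spectralmx A) *m rdiag (fun i => Num.sqrt (eigenv A i))).
rewrite adjM adjK adj_rdiag mulmxA -[_ *m rdiag _ *m rdiag _]mulmxA rdiagM.
rewrite [LHS]eA; congr (_ *m _ *m _); apply: eq_rdiag => i.
by rewrite -expr2 sqr_sqrtr // eigenv_ge0.
Qed.

(** With [M = B B^*], cyclicity turns the trace into that of the positive matrix [B^* A B]. *)
Lemma psd_trM_ge0 n (A M : 'M[C]_n) : psd A -> psd M -> 0 <= \tr (A *m M).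
Proof.
move=> pA /psd_factor[B ->]; rewrite mulmxA mxtrace_mulC mulmxA.
by have := psd_tr_ge0 (psd_cong (adj B) pA); rewrite adjK.
Qed.

End LinearAlgebra.

(** * Relative entropy compared with two-outcome projective tests *)

Section RelativeEntropy.
Variable R : realType.
Local Notation C := R[i].

Lemma gram_diag m n (A : 'M[C]_(m, n)) i :
  (A *m adj A) i i = (\sum_j sqn (A i j))%:C.
Proof.
by rewrite mxE rmorph_sum; apply: eq_bigr => j _; rewrite adjE sqnE.
Qed.

Lemma rdiag_cong_diag m n (A : 'M[C]_(m, n)) d i :
  (A *m rdiag d *m adj A) i i = (\sum_j d j * sqn (A i j))%:C.
Proof.
rewrite -mulmxA mxE rmorph_sum; apply: eq_bigr => j _.
by rewrite mul_rdiagE adjE mulrCA sqnE -rmorphM.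
Qed.

(** The difference of the two sides is [|s conj(x) - y|^2 / s]. The weight [s] stays free so that it
    can be tuned to each pair of eigenvalues. *)
Lemma Re_mul_le (x y : C) (s : R) : 0 < s ->
  2 * complex.Re (x * y) <= s * sqn x + sqn y / s.
Proof.
move=> s0; case: x y => a b [c d]; rewrite /sqn /=.
have -> : s * (a ^+ 2 + b ^+ 2) + (c ^+ 2 + d ^+ 2) / s =
   2 * (a * c - b * d) + ((s * a - c) ^+ 2 + (s * b + d) ^+ 2) / s.
  by field; rewrite gt_eqF.
by rewrite lerDl divr_ge0 ?addr_ge0 ?sqr_ge0 ?ltW.
Qed.

Lemma ln2_gt0 : 0 < ln 2 :> R.
Proof. by rewrite ln_gt0 // ltr1n. Qed.

Lemma ln2_ge_half : 1 / 2 <= ln 2 :> R.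
Proof.
have -> : ln 2 = - ln (1 + (- 2^-1)) :> R.
  by rewrite -lnV ?posrE; [congr ln; field | lra].
have := @le_ln1Dx R (- 2^-1); lra.
Qed.

Lemma log2V (x : R) : 0 < x -> log2 x^-1 = - log2 x.
Proof. by move=> x0; rewrite /log2 lnV ?posrE // mulNr. Qed.

Lemma log2M (x y : R) : 0 < x -> 0 < y -> log2 (x * y) = log2 x + log2 y.
Proof. by move=> x0 y0; rewrite /log2 lnM ?posrE // mulrDl. Qed.

Lemma log2_div (x y : R) : 0 < x -> 0 < y -> log2 (x / y) = log2 x - log2 y.
Proof. by move=> x0 y0; rewrite log2M ?invr_gt0 // log2V. Qed.

Lemma log2_ge0 (x : R) : 1 <= x -> 0 <= log2 x.
Proof.
move=> x1; apply: divr_ge0; first exact: ln_ge0.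
exact: ltW ln2_gt0.
Qed.

(** Concavity: on [[1, 2]] the logarithm lies above its chord, which joins [log2 1 = 0] to
    [log2 2 = 1]. *)
Lemma log2_1D_ge (u : R) : 0 <= u -> u <= 1 -> u <= log2 (1 + u).
Proof.
move=> u0 u1; rewrite /log2 ler_pdivlMr ?ln2_gt0 //.
have := @concave_ln R (Itv01 u0 u1) 2 1 (ltr0Sn R 1) (ltr01 : (0 : R) < 1).
rewrite !convRE /= ln1 mulr0 addr0 mulr1 => /le_trans; apply.
rewrite le_eqVlt; apply/orP; left; apply/eqP; congr ln.
by change (u * (2 : R) + (1 - u) = 1 + u); ring.
Qed.

(** Dyadic counterpart of integrating [a / (a + c b)] against [dc / c] over [c >= 1], which gives
    [ln (1 + a / b)]. Each term is at most a telescoping difference of logarithms, and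
    [log2 (1 + a / b)] exceeds [log2 (a / b)] by only [log2 (1 + b / a)]. *)
Lemma sum_resolvent_le (N : nat) (a b : R) : 0 < a -> 0 < b ->
  \sum_(j < N) a / (a + 2 ^+ j.+1 * b) <= log2 a - log2 b + 2 * (b / a).
Proof.
move=> a0 b0.
have step (j : nat) : a / (a + 2 ^+ j.+1 * b) <=
    log2 (1 + a / (2 ^+ j * b)) - log2 (1 + a / (2 ^+ j.+1 * b)).
  have c0 : 0 < 2 ^+ j :> R by rewrite exprn_gt0.
  have cb0 : 0 < 2 ^+ j * b by rewrite mulr_gt0.
  have cb20 : 0 < 2 ^+ j.+1 * b by rewrite mulr_gt0 // exprn_gt0.
  have d0 : 0 < a + 2 ^+ j.+1 * b by rewrite addr_gt0.
  rewrite -log2_div ?addr_gt0 ?divr_gt0 //.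
  (* The quotient is exactly [1 + u] with [0 <= u <= 1], so the chord bound applies. *)
  have -> : (1 + a / (2 ^+ j * b)) / (1 + a / (2 ^+ j.+1 * b)) =
            1 + a / (a + 2 ^+ j.+1 * b).
    by rewrite exprS in d0 cb20 *; field; rewrite !gt_eqF //= addrC.
  by apply: log2_1D_ge; [rewrite divr_ge0 ?ltW | rewrite ler_pdivrMr // mul1r lerDl ltW].
have : \sum_(j < N) a / (a + 2 ^+ j.+1 * b) <=
    log2 (1 + a / b) - log2 (1 + a / (2 ^+ N * b)).
  elim: N => [|N IH]; first by rewrite big_ord0 expr0 mul1r subrr.
  by rewrite big_ord_recr /=; have := step N; lra.
move=> /le_trans; apply.
have : 0 <= log2 (1 + a / (2 ^+ N * b)).
  by apply: log2_ge0; rewrite lerDl divr_ge0 ?mulr_ge0 ?exprn_ge0 // ltW.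
have -> : 1 + a / b = a / b * (1 + b / a) by field; rewrite !gt_eqF.
rewrite log2M ?divr_gt0 ?addr_gt0 ?divr_gt0 // log2_div //.
(* The factor 2 absorbs [1 / ln 2], by [ln 2 >= 1 / 2]. *)
have : log2 (1 + b / a) <= 2 * (b / a).
  rewrite /log2 ler_pdivrMr ?ln2_gt0 //.
  have t0 : 0 < b / a by rewrite divr_gt0.
  apply: le_trans (_ : b / a <= _); first by apply: le_ln1Dx; lra.
  have := ln2_ge_half; nra.
lra.
Qed.

(** The entries are the inner products [<a_i|b_j>] of eigenvectors of [rho] and [sigma]. This matrix
    is unitary, so its squared moduli [ovl] form a doubly stochastic matrix. *)
Definition overlap n (rho sigma : 'M[C]_n) : 'M[C]_n :=
  spectralmx rho *m adj (spectralmx sigma).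

Lemma overlap_unitary n (rho sigma : 'M[C]_n) : unitary (overlap rho sigma).
Proof.
have [UU UU'] := spectralmx_unitary rho.
have [VV VV'] := spectralmx_unitary sigma.
split; rewrite /overlap adjM adjK mulmxA.
- by rewrite -[_ *m _ *m spectralmx sigma]mulmxA VV' mulmx1.
- by rewrite -[_ *m _ *m spectralmx rho]mulmxA UU' mulmx1.
Qed.

Definition ovl n (rho sigma : 'M[C]_n) i j : R := sqn (overlap rho sigma i j).

Lemma ovl_ge0 n (rho sigma : 'M[C]_n) i j : 0 <= ovl rho sigma i j.
Proof. exact: sqn_ge0. Qed.

Lemma sum_ovl_row n (rho sigma : 'M[C]_n) i : \sum_j ovl rho sigma i j = 1.
Proof.
apply: (@complexI R); rewrite -gram_diag (overlap_unitary _ _).1.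
by rewrite mxE eqxx.
Qed.

Lemma sum_ovl_col n (rho sigma : 'M[C]_n) j : \sum_i ovl rho sigma i j = 1.
Proof.
apply: (@complexI R); transitivity ((1%:M : 'M[C]_n) j j); last by rewrite mxE eqxx.
rewrite -(overlap_unitary rho sigma).2 mxE rmorph_sum; apply: eq_bigr => i _.
by rewrite adjE mulrC sqnE.
Qed.

Lemma tr_spec_spec n (rho sigma : 'M[C]_n) (d e : 'I_n -> R) :
  \tr (spec (spectralmx rho) d *m spec (spectralmx sigma) e) =
  (\sum_i \sum_j ovl rho sigma i j * d i * e j)%:C.
Proof.
rewrite tr_specM rmorph_sum; apply: eq_bigr => i _ /=.
have -> : spectralmx rho *m spec (spectralmx sigma) e *m adj (spectralmx rho) =
    overlap rho sigma *m rdiag e *m adj (overlap rho sigma).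
  by rewrite /overlap /spec adjM adjK !mulmxA.
rewrite rdiag_cong_diag -rmorphM mulr_sumr; congr _%:C; apply: eq_bigr => j _.
by rewrite /ovl; ring.
Qed.

(** The row sums of [ovl] are 1, so the term [rho log rho] can be spread over the eigenbasis of
    [sigma] and both logarithms meet in one double sum. *)
Lemma relentE n (rho sigma : 'M[C]_n) : psd rho -> psd sigma ->
  relent rho sigma = \sum_i \sum_j ovl rho sigma i j * eigenv rho i *
    (log2 (eigenv rho i) - log2 (eigenv sigma j)).
Proof.
move=> [hr _] [hs _]; rewrite /relent.
have logE (A : 'M[C]_n) : adj A = A ->
    logm A = spec (spectralmx A) (fun i => log2 (eigenv A i)).
  by move=> hA; apply: (mxfun_spec (g := @log2 R)).
rewrite !logE // mulmxBr raddfB /= ReB.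
rewrite {1 4}(hermitian_spectral hr).1 specM; last exact: spectralmx_unitary.
rewrite tr_spec; last exact: spectralmx_unitary.
rewrite tr_spec_spec -sumrB; apply: eq_bigr => i _.
rewrite -[X in X - _]mul1r -(sum_ovl_row rho sigma i) mulr_suml -sumrB.
by apply: eq_bigr => j _; ring.
Qed.

Lemma tr_eigenv n (A : 'M[C]_n) : adj A = A -> \tr A = (\sum_i eigenv A i)%:C.
Proof.
by move=> hA; rewrite {1}(hermitian_spectral hA).1 tr_spec //; apply: spectralmx_unitary.
Qed.

(** An eigenvector of [sigma] for the eigenvalue 0 is killed by [rho], so its [rho]-expectation, a
    sum of nonnegative terms [eigenv rho i * ovl rho sigma i j], vanishes. This disposes of the
    terms where the logarithm of a zero eigenvalue of [sigma] would occur. *)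
Lemma supp_le_ovl n (rho sigma : 'M[C]_n) i j :
  psd rho -> psd sigma -> supp_le rho sigma ->
  0 < eigenv rho i -> eigenv sigma j = 0 -> ovl rho sigma i j = 0.
Proof.
move=> pr ps supp ai bj.
set v : 'cV[C]_n := adj (spectralmx sigma) *m delta_mx j 0.
have [VV _] := spectralmx_unitary sigma.
have [UU _] := spectralmx_unitary rho.
have /supp rv0 : sigma *m v = 0.
  rewrite /v {1}(hermitian_spectral ps.1).1 /spec mulmxA -[_ *m _ *m adj _]mulmxA.
  rewrite VV mulmx1 -mulmxA; apply/matrixP => k l.
  rewrite mxE big1 ?mxE // => h _; rewrite mul_rdiagE !mxE.
  by case: (h =P j) => [->|_]; rewrite ?bj ?mul0r ?mulr0.
have : (adj (overlap rho sigma) *m rdiag (eigenv rho) *m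
        adj (adj (overlap rho sigma))) j j = 0.
  rewrite /overlap !adjM !adjK !mulmxA.
  have -> : spectralmx sigma *m adj (spectralmx rho) *m rdiag (eigenv rho) *m
     spectralmx rho = spectralmx sigma *m rho.
    rewrite -!mulmxA; congr (_ *m _); rewrite !mulmxA.
    by exact: esym (hermitian_spectral pr.1).1.
  transitivity ((spectralmx sigma *m (rho *m v)) j 0).
    by rewrite /v !mulmxA -colE [RHS]mxE.
  by rewrite rv0 mulmx0 mxE.
rewrite rdiag_cong_diag => /(@complexI R) /eqP.
rewrite psumr_eq0; last by move=> k _; rewrite mulr_ge0 ?sqn_ge0 ?eigenv_ge0.
move=> /allP /(_ i); rewrite mem_index_enum => /(_ isT) /=.
by rewrite mulf_eq0 gt_eqF //= adjE sqn_conj => /eqP.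
Qed.

(** Klein's inequality: termwise [a (log2 a - log2 b) >= (a - b) / ln 2], and these lower bounds,
    weighted by the doubly stochastic [ovl], sum to [(Tr rho - Tr sigma) / ln 2 = 0]. *)
Lemma relent_ge0 n (rho sigma : 'M[C]_n) :
  density rho -> density sigma -> supp_le rho sigma -> 0 <= relent rho sigma.
Proof.
move=> [hr pr tr] [hs ps ts] supp; rewrite relentE //.
have Pr : psd rho := conj hr pr; have Ps : psd sigma := conj hs ps.
have : 0 <= (\sum_i \sum_j ovl rho sigma i j * (eigenv rho i - eigenv sigma j)) / ln 2.
  rewrite divr_ge0 ?(ltW ln2_gt0) //.
  have -> : \sum_i \sum_j ovl rho sigma i j * (eigenv rho i - eigenv sigma j) =
    \sum_i eigenv rho i - \sum_j eigenv sigma j.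
    under eq_bigr => i _ do (under eq_bigr => j _ do rewrite mulrBr;
      rewrite sumrB -mulr_suml sum_ovl_row mul1r).
    rewrite sumrB exchange_big /=; congr (_ - _); apply: eq_bigr => j _.
    by rewrite -mulr_suml sum_ovl_col mul1r.
  suff -> : \sum_i eigenv rho i = \sum_j eigenv sigma j by rewrite subrr.
  by apply: (@complexI R); rewrite -!tr_eigenv // tr ts.
move=> /le_trans; apply; rewrite mulr_suml; apply: ler_sum => i _.
rewrite mulr_suml; apply: ler_sum => j _.
have := eigenv_ge0 i Pr; have := eigenv_ge0 j Ps; have := ovl_ge0 rho sigma i j.
have := @supp_le_ovl _ rho sigma i j Pr Ps supp.
move: (ovl _ _ i j) (eigenv rho i) (eigenv sigma j) => w a b wab w0 b0.
rewrite le_eqVlt => /predU1P[<-|a0].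
  by rewrite mulr0 mul0r sub0r mulrN mulNr oppr_le0 divr_ge0 ?mulr_ge0 ?(ltW ln2_gt0).
move: b0; rewrite le_eqVlt => /predU1P[b0|b0].
  by rewrite wab // !mul0r.
rewrite -mulrA -mulrA ler_wpM2l // -log2_div // /log2 mulrA.
rewrite ler_wpM2r ?invr_ge0 ?(ltW ln2_gt0) //.
have := @le_ln1Dx R (b / a - 1); rewrite [1 + _]addrC subrK.
have -> : b / a = (a / b)^-1 by rewrite invf_div.
rewrite lnV ?posrE ?divr_gt0 // => h.
have : a * (- ln (a / b)) <= a * ((a / b)^-1 - 1).
  by rewrite ler_pM2l //; apply: h; rewrite ltrBDr addNr invr_gt0 divr_gt0.
have -> : a * ((a / b)^-1 - 1) = b - a by field; rewrite !gt_eqF.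
lra.
Qed.

(** The bounds [p - c q] for [c = 2, 4, ..., 2^N] are added up. The constant 2 on the right is
    [2 Tr sigma], the total of the errors [2 b / a] in [sum_resolvent_le]. *)
Lemma relent_ge_test n (rho sigma P : 'M[C]_n) (N : nat) (p q : R) :
  density rho -> density sigma -> supp_le rho sigma ->
  adj P = P -> P *m P = P -> \tr (P *m rho) = p%:C -> \tr (P *m sigma) = q%:C ->
  N%:R * p - 2 ^+ N.+1 * q <= relent rho sigma + 2.
Proof.
move=> [hr pr tr] [hs ps ts] supp hP PP trp trq.
have Pr : psd rho := conj hr pr; have Ps : psd sigma := conj hs ps.
set U := spectralmx rho; set V := spectralmx sigma.
set a := eigenv rho; set b := eigenv sigma; set w := ovl rho sigma.
have [UU UU'] : unitary U := spectralmx_unitary rho.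
have [VV VV'] : unitary V := spectralmx_unitary sigma.
(* [G j i] is [<b_j|P|a_i>]. As [P] is a projector, summing [|G j i|^2] over [j] gives
   [<a_i|P|a_i>], and over [i] gives [<b_j|P|b_j>]. *)
pose G := V *m P *m adj U.
have aG : \sum_i \sum_j a i * sqn (G j i) = p.
  apply: (@complexI R); rewrite -trp mxtrace_mulC {1}(hermitian_spectral hr).1.
  rewrite tr_specM rmorph_sum; apply: eq_bigr => i _; rewrite -mulr_sumr rmorphM.
  congr (_ * _); rewrite -/U -PP mulmxA.
  have -> : U *m P *m P *m adj U = adj G *m adj (adj G).
    by rewrite /G !adjM !adjK hP !mulmxA -[_ *m adj V *m V]mulmxA VV' mulmx1.
  by rewrite gram_diag; congr _%:C; apply: eq_bigr => j _; rewrite adjE sqn_conj.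
have bG : \sum_i \sum_j b j * sqn (G j i) = q.
  rewrite exchange_big; apply: (@complexI R).
  rewrite -trq mxtrace_mulC {1}(hermitian_spectral hs).1.
  rewrite tr_specM rmorph_sum; apply: eq_bigr => j _; rewrite -mulr_sumr rmorphM.
  congr (_ * _); rewrite -/V -PP mulmxA.
  have -> : V *m P *m P *m adj V = G *m adj G.
    by rewrite /G !adjM !adjK hP !mulmxA -[_ *m adj U *m U]mulmxA UU' mulmx1.
  by rewrite gram_diag.
(* Here [<a_i|P|a_i>] is split by inserting the eigenbasis of [sigma]: it is the sum over [j] of
   [<a_i|b_j><b_j|P|a_i>]. *)
have pE : \sum_i \sum_j a i * complex.Re (overlap rho sigma i j * G j i) = p.
  transitivity (complex.Re (\tr (P *m rho))); last by rewrite trp.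
  rewrite mxtrace_mulC [X in \tr (X *m P)](hermitian_spectral hr).1 tr_specM Re_sum.
  apply: eq_bigr => i _; rewrite -mulr_sumr Re_realM -Re_sum -/U -/a.
  congr (_ * complex.Re _); rewrite /overlap -/U -/V.
  have -> : U *m P *m adj U = U *m adj V *m G.
    by rewrite /G !mulmxA -[_ *m adj V *m V]mulmxA VV' mulmx1.
  by rewrite [RHS]mxE.
have a0 i : 0 <= a i by apply: eigenv_ge0.
have b0 j : 0 <= b j by apply: eigenv_ge0.
have w0 i j : 0 <= w i j by apply: ovl_ge0.
(* AM-GM termwise on [p = \sum a W G], using [\sum a |G|^2 = p] and [\sum b |G|^2 = q] *)
have resolvent (c : R) : 0 < c ->
    p - c * q <= \sum_i \sum_j w i j * a i * (a i / (a i + c * b j)).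
  move=> c0.
  suff : \sum_i \sum_j 2 * (a i * complex.Re (overlap rho sigma i j * G j i)) <=
     \sum_i \sum_j (w i j * a i * (a i / (a i + c * b j)) +
        (a i * sqn (G j i) + c * (b j * sqn (G j i)))).
    have -> : \sum_i \sum_j 2 * (a i * complex.Re (overlap rho sigma i j * G j i)) = 2 * p.
      by rewrite -pE mulr_sumr; apply: eq_bigr => i _; rewrite mulr_sumr.
    have -> : \sum_i \sum_j (w i j * a i * (a i / (a i + c * b j)) +
        (a i * sqn (G j i) + c * (b j * sqn (G j i)))) =
        \sum_i \sum_j w i j * a i * (a i / (a i + c * b j)) + (p + c * q).
      rewrite -aG -bG mulr_sumr -!big_split; apply: eq_bigr => i _ /=.
      by rewrite mulr_sumr -!big_split.
    lra.
  apply: ler_sum => i _; apply: ler_sum => j _.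
  have := a0 i; rewrite le_eqVlt => /predU1P[<-|ai].
    by rewrite !(mul0r, mulr0) !add0r !mulr_ge0 ?sqn_ge0 // ltW.
  have d0 : 0 < a i + c * b j by rewrite ltr_wpDr ?mulr_ge0 // ltW.
  have := @Re_mul_le (overlap rho sigma i j) (G j i) (a i / (a i + c * b j)).
  rewrite divr_gt0 // => /(_ isT) /(ler_wpM2l (ltW ai)).
  rewrite mulrCA => /le_trans; apply; rewrite le_eqVlt; apply/orP; left.
  by apply/eqP; rewrite /w /ovl; field; rewrite !gt_eqF.
(* Geometric sum: [2 + 4 + ... + 2^N = 2^(N+1) - 2]. *)
have -> : N%:R * p - 2 ^+ N.+1 * q =
    \sum_(l < N) (p - 2 ^+ l.+1 * q) - 2 * q.
  elim: (N) => [|M IH]; first by rewrite big_ord0; ring.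
  by rewrite big_ord_recr /= -natr1; move: IH; rewrite !exprS; lra.
have q0 : 0 <= q.
  by rewrite -bG; apply: sumr_ge0 => i _; apply: sumr_ge0 => j _; rewrite mulr_ge0 ?sqn_ge0.
apply: le_trans (_ : \sum_(l < N) (p - 2 ^+ l.+1 * q) <= _).
  by rewrite gerBl mulr_ge0.
apply: le_trans (_ : \sum_(l < N) \sum_i \sum_j
    w i j * a i * (a i / (a i + 2 ^+ l.+1 * b j)) <= _).
  by apply: ler_sum => l _; apply: resolvent; rewrite exprn_gt0.
(* The constant is distributed over the same double index as the entropy, so that it absorbs the
   error [2 b / a] term by term. *)
have two : 2 = \sum_i \sum_j 2 * (w i j * b j) :> R.
  rewrite exchange_big /=.
  under eq_bigr => j _ do rewrite -mulr_sumr -mulr_suml sum_ovl_col mul1r.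
  rewrite -mulr_sumr (_ : \sum_j b j = 1) ?mulr1 //.
  by apply: (@complexI R); rewrite -tr_eigenv // ts.
rewrite relentE // [X in _ <= _ + X]two -big_split exchange_big /=; apply: ler_sum => i _.
rewrite -big_split exchange_big /=; apply: ler_sum => j _.
rewrite -mulr_sumr -/w -/a -/b.
have := a0 i; rewrite le_eqVlt => /predU1P[<-|ai].
  by rewrite !(mul0r, mulr0) add0r !mulr_ge0.
have := b0 j; rewrite le_eqVlt => /predU1P[bj|bj].
  by rewrite /w (supp_le_ovl Pr Ps supp ai (esym bj)) !(mul0r, mulr0) addr0.
have /(ler_wpM2l (mulr_ge0 (w0 i j) (a0 i))) := sum_resolvent_le N ai bj.
move=> /le_trans; apply; rewrite le_eqVlt; apply/orP; left.
by apply/eqP; field; rewrite gt_eqF.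
Qed.

(** Take [N] to be the integer part of [log2 L]. Rounding costs one [p] and [2^(N+1) q <= 2 p] costs
    two more, so with [p <= 1] the constant grows from 2 to 5. *)
Lemma tail_prob_le n (rho sigma P : 'M[C]_n) (L p q : R) :
  density rho -> density sigma -> supp_le rho sigma ->
  adj P = P -> P *m P = P -> \tr (P *m rho) = p%:C -> \tr (P *m sigma) = q%:C ->
  0 <= p <= 1 -> 1 <= L -> L * q <= p -> p * log2 L <= relent rho sigma + 5.
Proof.
move=> dr ds supp hP PP trp trq /andP[p0 p1] L1 Lqp.
have l0 : 0 <= log2 L by apply: log2_ge0.
have /andP[Nl lN] := truncn_itv l0; set N := Num.truncn _ in Nl lN.
have NL : 2 ^+ N <= L.
  rewrite -ler_ln ?posrE ?exprn_gt0 ?(lt_le_trans _ L1) // lnXn ?ltr0n //.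
  by move: Nl; rewrite /log2 ler_pdivlMr ?ln2_gt0 // mulr_natl.
have aux (k l c y : R) : p * l <= p * (c + 1) -> y * q <= p ->
    c * p - 2 * y * q <= k + 2 -> p * l <= k + 5.
  by clear -p1; lra.
apply: (aux _ _ N%:R (2 ^+ N)).
- by rewrite ler_wpM2l // natr1 ltW.
- have [q0|q0] := leP 0 q; first by apply: le_trans Lqp; rewrite ler_wpM2r.
  by apply: le_trans p0; rewrite mulr_ge0_le0 // ?exprn_ge0 // ltW.
by rewrite -exprS; apply: relent_ge_test PP trp trq.
Qed.

End RelativeEntropy.

(** * Continuity of complex matrix functions, entry by entry *)

Section Continuity.
Variables (R : realType) (T : topologicalType).
Local Notation C := R[i].

(** Real and imaginary parts are treated separately, which reduces each closure property below to
    one about real functions. *)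
Definition ccont (f : T -> C) : Prop :=
  continuous (fun x => complex.Re (f x)) /\ continuous (fun x => complex.Im (f x)).

Lemma ccont_ext (f g : T -> C) : f =1 g -> ccont f -> ccont g.
Proof. by move=> /funext ->. Qed.

Lemma ccont_cst (c : C) : ccont (fun=> c).
Proof. by split=> x; apply: cvg_cst. Qed.

Lemma ccontD (f g : T -> C) : ccont f -> ccont g -> ccont (fun x => f x + g x).
Proof.
move=> [fr fi] [gr gi]; split.
- have -> : (fun x => complex.Re (f x + g x)) =
     (fun x => complex.Re (f x) + complex.Re (g x)).
    by apply/funext => x; case: (f x) (g x) => ? ? [].
  by move=> x; apply: cvgD; [apply: fr | apply: gr].
- have -> : (fun x => complex.Im (f x + g x)) =
     (fun x => complex.Im (f x) + complex.Im (g x)).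
    by apply/funext => x; case: (f x) (g x) => ? ? [].
  by move=> x; apply: cvgD; [apply: fi | apply: gi].
Qed.

Lemma continuous_ReDZ (f g : T -> C) (a : R) : ccont f -> ccont g ->
  continuous (fun x => complex.Re (f x) + a * complex.Re (g x)).
Proof.
move=> [fr _] [gr _] x; apply: cvgD; first exact: fr.
by apply: cvgM; [apply: cvg_cst | apply: gr].
Qed.

Lemma ccontM (f g : T -> C) : ccont f -> ccont g -> ccont (fun x => f x * g x).
Proof.
move=> [fr fi] [gr gi]; split.
- have -> : (fun x => complex.Re (f x * g x)) =
     (fun x => complex.Re (f x) * complex.Re (g x) - complex.Im (f x) * complex.Im (g x)).
    by apply/funext => x; case: (f x) (g x) => ? ? [].
  by move=> x; apply: cvgB; apply: cvgM; [apply: fr|apply: gr|apply: fi|apply: gi].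
- have -> : (fun x => complex.Im (f x * g x)) =
     (fun x => complex.Re (f x) * complex.Im (g x) + complex.Im (f x) * complex.Re (g x)).
    by apply/funext => x; case: (f x) (g x) => ? ? [].
  by move=> x; apply: cvgD; apply: cvgM; [apply: fr|apply: gi|apply: fi|apply: gr].
Qed.

Lemma ccont_conj (f : T -> C) : ccont f -> ccont (fun x => conjc (f x)).
Proof.
move=> [fr fi]; split.
- have -> // : (fun x => complex.Re (conjc (f x))) = (fun x => complex.Re (f x)).
  by apply/funext => x; case: (f x).
- have -> : (fun x => complex.Im (conjc (f x))) = (fun x => - complex.Im (f x)).
    by apply/funext => x; case: (f x).
  by move=> x; apply: cvgN; apply: fi.
Qed.

(** From [1 / z = conj(z) / |z|^2], whose denominator is real and nonzero. *)
Lemma ccontV (f : T -> C) : (forall x, f x != 0) -> ccont f ->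
  ccont (fun x => (f x)^-1).
Proof.
move=> f0 [fr fi].
pose h x : R := (complex.Re (f x) ^+ 2 + complex.Im (f x) ^+ 2)^-1.
have -> : (fun x => (f x)^-1) = (fun x => conjc (f x) * (h x)%:C).
  apply/funext => x.
  have -> : (h x)%:C = (f x * conjc (f x))^-1 by rewrite sqnE -fmorphV.
  by rewrite invfM mulrCA mulfV ?mulr1 // conjc_eq0.
apply: ccontM; first by apply: ccont_conj.
split; last by move=> x; apply: cvg_cst.
move=> x; apply: cvgV.
  by apply: contra (f0 x) => /eqP /sqn_eq0 ->.
by apply: cvgD; rewrite expr2; apply: cvgM; [apply: fr|apply: fr|apply: fi|apply: fi].
Qed.

Lemma ccont_sum (I : Type) (s : seq I) (P : pred I) (F : I -> T -> C) :
  (forall i, ccont (F i)) -> ccont (fun x => \sum_(i <- s | P i) F i x).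
Proof.
move=> cF; elim: s => [|i s IH].
  by apply: ccont_ext (ccont_cst 0) => x; rewrite big_nil.
case Pi: (P i).
  by apply: ccont_ext (ccontD (cF i) IH) => x; rewrite big_cons Pi.
by apply: ccont_ext IH => x; rewrite big_cons Pi.
Qed.

Lemma ccont_prod (I : Type) (s : seq I) (P : pred I) (F : I -> T -> C) :
  (forall i, ccont (F i)) -> ccont (fun x => \prod_(i <- s | P i) F i x).
Proof.
move=> cF; elim: s => [|i s IH].
  by apply: ccont_ext (ccont_cst 1) => x; rewrite big_nil.
case Pi: (P i).
  by apply: ccont_ext (ccontM (cF i) IH) => x; rewrite big_cons Pi.
by apply: ccont_ext IH => x; rewrite big_cons Pi.
Qed.

Definition mcont m n (F : T -> 'M[C]_(m, n)) : Prop :=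
  forall i j, ccont (fun x => F x i j).

Lemma mcont_cst m n (A : 'M[C]_(m, n)) : mcont (fun=> A).
Proof. by move=> i j; apply: ccont_cst. Qed.

Lemma mcontD m n (F G : T -> 'M[C]_(m, n)) :
  mcont F -> mcont G -> mcont (fun x => F x + G x).
Proof.
by move=> cF cG i j; apply: ccont_ext (ccontD (cF i j) (cG i j)) => x; rewrite mxE.
Qed.

Lemma mcontM m n p (F : T -> 'M[C]_(m, n)) (G : T -> 'M[C]_(n, p)) :
  mcont F -> mcont G -> mcont (fun x => F x *m G x).
Proof.
move=> cF cG i j.
have := @ccont_sum _ (index_enum 'I_n) xpredT (fun k x => F x i k * G x k j).
move=> /(_ _) h; apply: ccont_ext (h _) => [x|k]; first by rewrite mxE.
exact: ccontM.
Qed.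

Lemma mcont_adj m n (F : T -> 'M[C]_(m, n)) :
  mcont F -> mcont (fun x => adj (F x)).
Proof.
by move=> cF i j; apply: ccont_ext (ccont_conj (cF j i)) => x; rewrite adjE.
Qed.

Lemma ccont_tr n (F : T -> 'M[C]_n) : mcont F -> ccont (fun x => \tr (F x)).
Proof. by move=> cF; apply: ccont_sum => i; apply: cF. Qed.

Lemma ccont_det n (F : T -> 'M[C]_n) : mcont F -> ccont (fun x => \det (F x)).
Proof.
move=> cF; apply: ccont_sum => s; apply: ccontM; first exact: ccont_cst.
by apply: ccont_prod => i; apply: cF.
Qed.

(** Cramer's rule: the entries of the inverse are cofactors divided by the determinant, which never
    vanishes here. *)
Lemma mcont_inv n (F : T -> 'M[C]_n) : (forall x, F x \in unitmx) ->
  mcont F -> mcont (fun x => invmx (F x)).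
Proof.
move=> uF cF i j.
have cdet : ccont (fun x => (\det (F x))^-1).
  apply: ccontV (ccont_det cF) => x.
  by have := uF x; rewrite unitmxE unitfE.
have ccof : ccont (fun x => cofactor (F x) j i).
  apply: ccontM; first exact: ccont_cst.
  by apply: ccont_det => k l; apply: ccont_ext (cF (lift j k) (lift i l)) => x; rewrite !mxE.
by apply: ccont_ext (ccontM cdet ccof) => x; rewrite /invmx uF !mxE.
Qed.

End Continuity.
Arguments mcont_cst {R T m n} A.

(** * Minimisation of the dual functional *)

Section Minimizer.
Variable R : realType.
Local Notation C := R[i].

(** Real coordinates on complex matrices, so that compactness and the extreme value theorem can be
    applied to real row vectors. *)
Definition decode n (x : 'rV[R]_(n * n + n * n)) : 'M[C]_n :=
  \matrix_(i, j) (x 0 (lshift _ (mxvec_index i j)) +i*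
                  x 0 (rshift _ (mxvec_index i j))).

Definition encode n (A : 'M[C]_n) : 'rV[R]_(n * n + n * n) :=
  row_mx (mxvec (map_mx (@complex.Re R) A)) (mxvec (map_mx (@complex.Im R) A)).

Lemma encodeK n : cancel (@encode n) (@decode n).
Proof.
move=> A; apply/matrixP => i j; rewrite mxE /encode row_mxEl row_mxEr !mxvecE !mxE.
by case: (A i j).
Qed.

Lemma encode_bounded n (A : 'M[C]_n) (b : R) :
  \sum_i \sum_j sqn (A i j) <= b -> forall k, `|encode A 0 k| <= Num.sqrt b.
Proof.
move=> Ab; have Aij i j : sqn (A i j) <= b.
  apply: le_trans Ab; rewrite (bigD1 i) //= (bigD1 j) //= -addrA lerDl.
  by rewrite addr_ge0 ?sumr_ge0 // => *; rewrite ?sumr_ge0 // => *; apply: sqn_ge0.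
have bound (x : R) i j : x ^+ 2 <= sqn (A i j) -> `|x| <= Num.sqrt b.
  by move=> h; rewrite -sqrtr_sqr ler_wsqrtr // (le_trans h).
move=> k; rewrite /encode; case: (split_ordP k) => l ->.
- rewrite row_mxEl; case/mxvec_indexP: l => i j; rewrite mxvecE mxE.
  by apply: (bound _ i j); rewrite /sqn lerDl sqr_ge0.
- rewrite row_mxEr; case/mxvec_indexP: l => i j; rewrite mxvecE mxE.
  by apply: (bound _ i j); rewrite /sqn lerDr sqr_ge0.
Qed.

Lemma mcont_decode n : mcont (@decode n).
Proof.
move=> i j; split.
- have -> : (fun x => complex.Re (decode x i j)) =
     (fun x : 'rV[R]_(n * n + n * n) => x 0 (lshift _ (mxvec_index i j))).
    by apply/funext => x; rewrite mxE.
  exact: coord_continuous.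
- have -> : (fun x => complex.Im (decode x i j)) =
     (fun x : 'rV[R]_(n * n + n * n) => x 0 (rshift _ (mxvec_index i j))).
    by apply/funext => x; rewrite mxE.
  exact: coord_continuous.
Qed.

Definition resol n (M : 'M[C]_n) : 'M[C]_n := invmx (1%:M + M).

Lemma resol_spec n (M : 'M[C]_n) : psd M ->
  1%:M + M \in unitmx /\
  resol M = spec (spectralmx M) (fun i => (1 + eigenv M i)^-1).
Proof.
move=> pM; have uU := spectralmx_unitary M.
have e : (1%:M + M) *m spec (spectralmx M) (fun i => (1 + eigenv M i)^-1) = 1%:M.
  have -> : 1%:M + M = spec (spectralmx M) (fun i => 1 + eigenv M i).
    by rewrite -specD (spec1 uU) -(hermitian_spectral pM.1).1.
  rewrite specM // -(spec1 uU).
  apply: eq_spec => i; rewrite mulfV // gt_eqF //.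
  by apply: ltr_pwDl => //; apply: eigenv_ge0.
have [u _] := mulmx1_unit e; split=> //.
by rewrite -[LHS]mulmx1 -e mulmxA mulVmx // mul1mx.
Qed.

Lemma mulresol n (M : 'M[C]_n) : psd M -> (1%:M + M) *m resol M = 1%:M.
Proof. by move=> /resol_spec[u _]; apply: mulmxV. Qed.

Lemma resolmul n (M : 'M[C]_n) : psd M -> resol M *m (1%:M + M) = 1%:M.
Proof. by move=> /resol_spec[u _]; apply: mulVmx. Qed.

Lemma psd_resol n (M : 'M[C]_n) : psd M -> psd (resol M).
Proof.
move=> pM; rewrite (resol_spec pM).2; apply: psd_spec => i.
by rewrite invr_ge0 addr_ge0 // eigenv_ge0.
Qed.

Definition objective n (rho sigma : 'M[C]_n) (L : R) (M : 'M[C]_n) : R :=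
  complex.Re (\tr (rho *m resol M)) + L * complex.Re (\tr (sigma *m M)).

(** Writing [M = G G^*] with [G = Q A] builds in both constraints on [M]. Coercivity comes from
    [Q <= K sigma], which gives [Tr M <= K Tr sigma M]: every competitor no worse than [M = 0] then
    comes from a fixed compact box. *)
Lemma objective_min_exists n (rho sigma Q : 'M[C]_n) (L K : R) :
  psd rho -> psd sigma -> 0 < L -> 0 <= K ->
  adj Q = Q -> Q *m Q = Q -> psd (K%:C *: sigma - Q) ->
  exists M, [/\ psd M, Q *m M *m Q = M & forall M', psd M' -> Q *m M' *m Q = M' ->
    objective rho sigma L M <= objective rho sigma L M'].
Proof.
move=> pr ps L0 K0 hQ QQ pK.
pose gram (A : 'M[C]_n) := (Q *m A) *m adj (Q *m A).
pose f x := objective rho sigma L (gram (decode x)).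
pose b := K * complex.Re (\tr rho) / L.
pose box := [set v : 'rV[R]_(n * n + n * n) | forall i,
  `[(- Num.sqrt b), (Num.sqrt b)]%classic (v ord0 i)]%classic.
have boxE v : (v \in box) <-> forall i, `|v ord0 i| <= Num.sqrt b.
  rewrite inE; split=> h i; have := h i; rewrite /= in_itv /= ler_norml //.
have box0 : encode 0 \in box.
  apply/boxE => i; rewrite (_ : encode 0 = 0) ?mxE ?normr0 ?sqrtr_ge0 //.
  apply/rowP => k; rewrite /encode; case: (split_ordP k) => l ->.
  - by rewrite row_mxEl; case/mxvec_indexP: l => ? ?; rewrite mxvecE !mxE.
  - by rewrite row_mxEr; case/mxvec_indexP: l => ? ?; rewrite mxvecE !mxE.
have fcont : continuous f.
  have cg : mcont (fun x => gram (decode x)).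
    have cQ := mcontM (mcont_cst Q) (@mcont_decode n).
    exact: mcontM cQ (mcont_adj cQ).
  have cr : mcont (fun x => resol (gram (decode x))).
    apply: mcont_inv => [x|]; first by have [] := resol_spec (psd_gram (Q *m decode x)).
    exact: mcontD (mcont_cst _) cg.
  exact: continuous_ReDZ (ccont_tr (mcontM (mcont_cst rho) cr))
    (ccont_tr (mcontM (mcont_cst sigma) cg)).
have bcomp : compact box.
  by apply: (@rV_compact _ _ (fun=> _)) => i; apply: segment_compact.
have [|c _ cmin] := EVT_min_rV _ bcomp (continuous_subspaceT fcont).
  by exists (encode 0); rewrite -inE.
have QG A : Q *m gram A *m Q = gram A.
  by rewrite /gram adjM hQ !mulmxA QQ -[_ *m Q *m Q]mulmxA QQ.
exists (gram (decode c)); split=> [||M' pM' QM'].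
- exact: psd_gram.
- exact: QG.
have f0 : f c <= complex.Re (\tr rho).
  apply: le_trans (cmin _ box0) _.
  rewrite /f encodeK /gram mulmx0 mul0mx /objective /resol addr0 invmx1 mulmx1.
  by rewrite mulmx0 raddf0 mulr0 addr0.
(* A competitor with value above [Tr rho], the value at [M = 0], already loses to the minimiser on
   the box, which contains 0. *)
have [big|small] := ltP (complex.Re (\tr rho)) (objective rho sigma L M').
  exact: le_trans f0 (ltW big).
have [A eA] := psd_factor pM'.
have gA : gram A = M'.
  by rewrite /gram adjM hQ mulmxA -[Q *m A *m adj A]mulmxA -eA.
have eQA : decode (encode (Q *m A)) = Q *m A by apply: encodeK.
(* [A] is replaced by [Q A], which has the same [gram] and whose squared entries sum to [Tr M']. *)
rewrite -gA; have -> : gram A = gram (decode (encode (Q *m A))).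
  by rewrite eQA /gram mulmxA QQ.
apply: cmin; apply/boxE; apply: encode_bounded.
have e : complex.Re (\tr M') = \sum_i \sum_j sqn ((Q *m A) i j).
  by rewrite -gA /gram tr_gram.
rewrite -e.
have QM : Q *m M' = M' by rewrite -QM' !mulmxA QQ.
have := Re_ge0 (psd_trM_ge0 pK pM').
rewrite mulmxBl QM -scalemxAl raddfB /= mxtraceZ ReB Re_realM subr_ge0 => /le_trans.
apply; rewrite /b -mulrA ler_wpM2l // ler_pdivlMr // mulrC.
apply: le_trans small; rewrite /objective lerDr.
exact: Re_ge0 (psd_trM_ge0 pr (psd_resol pM')).
Qed.

Lemma supp_le_mul n m (rho sigma : 'M[C]_n) (A : 'M[C]_(n, m)) :
  supp_le rho sigma -> sigma *m A = 0 -> rho *m A = 0.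
Proof.
move=> supp sA; apply/matrixP => i j.
have : rho *m col j A = 0 by apply: supp; rewrite colE mulmxA sA mul0mx.
by rewrite colE mulmxA -colE => /matrixP/(_ i 0); rewrite !mxE.
Qed.

(** [Q] projects onto the range of [sigma]; confining the minimisation to it makes the dual
    functional coercive. *)
Lemma support_projector n (sigma : 'M[C]_n) : psd sigma ->
  exists (Q : 'M[C]_n) (K : R), [/\ adj Q = Q, Q *m Q = Q, sigma *m Q = sigma,
    0 <= K & psd (K%:C *: sigma - Q)] /\
    forall rho, supp_le rho sigma -> rho *m Q = rho.
Proof.
move=> ps; have uV := spectralmx_unitary sigma.
set V := spectralmx sigma in uV; set b := eigenv sigma.
have sE : sigma = spec V b := (hermitian_spectral ps.1).1.
have b0 i : 0 <= b i by apply: eigenv_ge0.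
(* As [0^-1 = 0], zero eigenvalues add nothing; for the others [K b_i >= b_i^-1 b_i = 1], hence
   [Q <= K sigma]. *)
pose K : R := \sum_i (b i)^-1.
have K0 : 0 <= K by apply: sumr_ge0 => i _; rewrite invr_ge0.
exists (spec V (fun i => (b i != 0)%:R)), K; split; first split.
- exact: adj_spec.
- by rewrite (specM _ _ uV); apply: eq_spec => i; case: eqP; rewrite /= ?mulr0 ?mulr1.
- rewrite {1}sE (specM _ _ uV) [RHS]sE; apply: eq_spec => i.
  by case: eqP => [->|]; rewrite /= ?mulr0 ?mulr1.
- exact: K0.
- rewrite sE specZ specB.
  apply: psd_spec => i; rewrite subr_ge0; case: eqP => [->|/eqP bi] /=.
    by rewrite mulr0.
  rewrite -(mulVf bi) ler_wpM2r // /K (bigD1 i) //= lerDl.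
  by apply: sumr_ge0 => j _; rewrite invr_ge0.
move=> rho supp; apply/eqP; rewrite -subr_eq0 -{2}[rho]mulmx1 -mulmxBr; apply/eqP.
apply: (supp_le_mul supp); rewrite -(spec1 uV).
rewrite specB {1}sE (specM _ _ uV) /spec; have -> : rdiag (fun i => b i * ((b i != 0)%:R - 1)) = 0.
  apply/matrixP => i j; rewrite rdiagE mxE; case: eqP => [->|_] /=.
    by rewrite mul0r mul0rn.
  by rewrite subrr mulr0 mul0rn.
by rewrite mulmx0 mul0mx.
Qed.

Lemma form_tr n (A : 'M[C]_n) (w : 'cV[C]_n) :
  (adj w *m A *m w) 0 0 = \tr (A *m (w *m adj w)).
Proof. by rewrite mulmxA mxtrace_mulC mulmxA /mxtrace big_ord1. Qed.

Lemma resol_diff n (M M' : 'M[C]_n) : psd M -> psd M' ->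
  resol M - resol M' = resol M' *m (M' - M) *m resol M.
Proof.
move=> pM pM'; have -> : M' - M = (1%:M + M') - (1%:M + M).
  by rewrite opprD addrACA subrr add0r.
by rewrite mulmxBr mulmxBl resolmul // mul1mx -mulmxA mulresol // mulmx1.
Qed.

Lemma shift_le (a a' l x c : R) : a + l * c <= a' + l * (c + x) -> a - a' <= l * x.
Proof. lra. Qed.

Lemma shift_ge (a a' l x c : R) : a + l * c <= a' + l * (c - x) -> l * x <= a' - a.
Proof. lra. Qed.

(** * Optimality conditions at a minimiser, and the resulting multiplier *)

Section FirstOrder.
Variables (n : nat) (rho sigma Q M : 'M[C]_n) (L : R).
Hypotheses (pr : psd rho) (ps : psd sigma) (L0 : 0 < L).
Hypotheses (hQ : adj Q = Q) (QQ : Q *m Q = Q).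
Hypotheses (pM : psd M) (QMQ : Q *m M *m Q = M).
Hypothesis minM : forall M', psd M' -> Q *m M' *m Q = M' ->
  objective rho sigma L M <= objective rho sigma L M'.

Let T := resol M.

(** The derivative of the objective at [M] in the admissible direction [W = w w^*] is nonnegative.
    It is obtained by comparing [M] with [M + e W] for every [e > 0] and letting [e] tend to 0. *)
Lemma first_order_rank1 (w : 'cV[C]_n) : Q *m w = w ->
  complex.Re (\tr (T *m rho *m T *m (w *m adj w))) <=
  L * complex.Re (\tr (sigma *m (w *m adj w))).
Proof.
move=> Qw; have pw := psd_gram w.
have pT : psd T := psd_resol pM.
set W := w *m adj w in pw *.
set t := complex.Re (\tr (T *m W)).
have t0 : 0 <= t by apply: Re_ge0; apply: psd_trM_ge0.
set s := complex.Re (\tr (sigma *m W)).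
have s0 : 0 <= s by apply: Re_ge0; apply: psd_trM_ge0.
set y := complex.Re _.
have key (e : R) : 0 < e -> y <= L * s + e * t * (L * s).
  move=> e0; pose M' := M + e%:C *: W.
  have pM' : psd M' := psdD pM (psdZ (ltW e0) pw).
  have QM' : Q *m M' *m Q = M'.
    rewrite /M' mulmxDr mulmxDl QMQ -scalemxAr -scalemxAl; congr (_ + _ *: _).
    by rewrite /W mulmxA Qw -mulmxA -{1}hQ -adjM Qw.
  have := minM pM' QM'; rewrite /objective -/T.
  (* Sherman-Morrison formula for the rank-one update, with [t = <w|T|w>]; it makes the change of
     the objective exact. *)
  have T'w : (1 + e * t)%:C *: (resol M' *m w) = T *m w.
    have -> : T *m w = resol M' *m ((1%:M + M') *m (T *m w)).
      by rewrite mulmxA resolmul // mul1mx.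
    rewrite scalemxAr; congr (_ *m _).
    have -> : 1%:M + M' = (1%:M + M) + e%:C *: W by rewrite addrA.
    rewrite mulmxDl mulmxA mulresol // mul1mx -scalemxAl /W -mulmxA.
    have -> : adj w *m (T *m w) = t%:C%:M.
      rewrite mulmxA; apply/matrixP => i j; rewrite !ord1 form_tr !mxE eqxx.
      by rewrite {1}(ge0_ReE (psd_trM_ge0 pT pw)).
    by rewrite mul_mx_scalar scalerA rmorphD rmorphM scalerDl scale1r.
  have et0 : 0 < 1 + e * t by rewrite ltr_pwDl // mulr_ge0 // ltW.
  have dT : (1 + e * t)%:C * \tr (rho *m (T - resol M')) = e%:C * \tr (T *m rho *m T *m W).
    rewrite (resol_diff pM pM') -/T (_ : M' - M = e%:C *: W); last by rewrite addrC addKr.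
    rewrite -scalemxAr -scalemxAl -scalemxAr mxtraceZ mulrCA; congr (_ * _).
    have -> : rho *m (resol M' *m W *m T) = rho *m (resol M' *m w) *m (adj w *m T).
      by rewrite /W !mulmxA.
    rewrite -mxtraceZ scalemxAl scalemxAr T'w.
    by rewrite /W !mulmxA mxtrace_mulC !mulmxA.
  rewrite {1}/M' mulmxDr -scalemxAr mxtraceD mxtraceZ ReD Re_realM -/s => h.
  have : complex.Re (\tr (rho *m (T - resol M'))) <= L * (e * s).
    by rewrite mulmxBr raddfB /= ReB; apply: shift_le h.
  rewrite -(ler_pM2l et0) -Re_realM dT Re_realM -/y => h2.
  rewrite -(ler_pM2l e0); apply: le_trans h2 _; rewrite le_eqVlt; apply/orP; left.
  by apply/eqP; ring.
rewrite -/y; apply/ler_addgt0Pr => d d0.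
have ts0 : 0 <= t * (L * s) by rewrite !mulr_ge0 // ltW.
(* This choice of [e] makes the excess [e t L s] at most [d]; the added 1 keeps the denominator
   positive when [t L s = 0]. *)
apply: le_trans (key (d / (t * (L * s) + 1)) _) _; first by rewrite divr_gt0 // ltr_wpDl.
rewrite lerD2l -mulrA -mulrA ler_piMr ?(ltW d0) //.
by rewrite mulrC ler_pdivrMr ?ltr_wpDl // mul1r lerDl.
Qed.

(** The eigenvalue [d] is removed outright: [M' = M - d W], with [W] the projector on the
    eigenvector. Minimality gives [L d Tr sigma W <= d / (1 + d) Tr rho W]; divide by [d] and bound
    [1 / (1 + d)] by 1. *)
Lemma first_order_eigen i : 0 < eigenv M i ->
  L * complex.Re ((spectralmx M *m sigma *m adj (spectralmx M)) i i) <=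
  complex.Re ((spectralmx M *m rho *m adj (spectralmx M)) i i).
Proof.
move=> di; have uU := spectralmx_unitary M.
set U := spectralmx M in uU *; set d := eigenv M in di *.
have d0 j : 0 <= d j by apply: eigenv_ge0.
have ME : M = spec U d := (hermitian_spectral pM.1).1.
pose W := spec U (fun j => (j == i)%:R).
have diagE (A : 'M[C]_n) : (U *m A *m adj U) i i = \tr (A *m W).
  rewrite mxtrace_mulC tr_specM (bigD1 i) //= eqxx mul1r big1 ?addr0 // => j ji.
  by rewrite (negPf ji) mul0r.
rewrite !diagE.
have MW : M *m W = (d i)%:C *: W.
  rewrite ME /W (specM _ _ uU) specZ; apply: eq_spec => j.
  by case: (j =P i) => [->|_]; rewrite ?mulr0.
have di0 : (d i)%:C != 0 :> C by rewrite eq_complex /= eqxx andbT gt_eqF.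
have QM : Q *m M = M by rewrite -QMQ !mulmxA QQ.
(* The eigenvalue being nonzero, [W] lives on the range of [M], hence of [Q]; this keeps [M']
   admissible. *)
have QW : Q *m W = W.
  by apply: (scalerI di0); rewrite scalemxAr -MW mulmxA QM.
have hW : adj W = W := adj_spec _ _.
have WQ : W *m Q = W by rewrite -{1}hW -{1}hQ -adjM QW.
pose M' := spec U (fun j => d j *+ (j != i)).
have M'E : M' = M - (d i)%:C *: W.
  rewrite ME /M' /W specZ specB; apply: eq_spec => j.
  by case: (j =P i) => [->|_]; rewrite ?mulr1 ?subrr ?mulr0 ?subr0.
have pM' : psd M' by apply: psd_spec => j; rewrite mulrn_wge0.
have QM' : Q *m M' *m Q = M'.
  by rewrite M'E mulmxBr mulmxBl QMQ -scalemxAr -scalemxAl QW WQ.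
have TE : T = spec U (fun j => (1 + d j)^-1) := (resol_spec pM).2.
have TW : T *m W = ((1 + d i)^-1)%:C *: W.
  rewrite TE /W (specM _ _ uU) specZ; apply: eq_spec => j.
  by case: (j =P i) => [->|_]; rewrite ?mulr0.
have WT : W *m T = ((1 + d i)^-1)%:C *: W.
  have hT : adj T = T := (psd_resol pM).1.
  by rewrite -{1}hW -{1}hT -adjM TW adj_scale hW.
have WW : W *m W = W.
  by rewrite (specM _ _ uU); apply: eq_spec => j; case: eqP; rewrite ?mulr1 ?mulr0.
have M'W : (1%:M + M') *m W = W.
  by rewrite mulmxDl mul1mx M'E mulmxBl MW -scalemxAl WW subrr addr0.
have T'W : resol M' *m W = W by rewrite -[in LHS]M'W mulmxA (resolmul pM') mul1mx.
have dT : resol M' - T = (d i * (1 + d i)^-1)%:C *: W.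
  have dM : M' - M = - ((d i)%:C *: W) by rewrite M'E addrC addKr.
  rewrite -[LHS]opprB (resol_diff pM pM') dM mulmxN mulNmx opprK.
  by rewrite -scalemxAr -scalemxAl T'W WT scalerA rmorphM.
have sM' : \tr (sigma *m M') = \tr (sigma *m M) - (d i)%:C * \tr (sigma *m W).
  by rewrite M'E mulmxBr -scalemxAr raddfB /= mxtraceZ.
have := minM pM' QM'; rewrite /objective sM' ReB Re_realM => h.
have : L * (d i * complex.Re (\tr (sigma *m W))) <=
    complex.Re (\tr (rho *m (resol M' - T))).
  by rewrite mulmxBr raddfB /= ReB; apply: shift_ge h.
rewrite dT -scalemxAr mxtraceZ Re_realM mulrCA -mulrA ler_pM2l // => /le_trans; apply.
rewrite ler_piMl ?invf_le1 ?lerDl ?ltr_wpDr ?d0 //.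
rewrite -diagE; apply: Re_ge0; apply: psd_diag_ge0; exact: psd_cong.
Qed.
End FirstOrder.

(* The dual optimum: [M] is the Lagrange multiplier of the constraint
   [B B^* <= L sigma] in the projection of a purification [X] of [rho] onto it,
   the projection being [B = (1 + M)^-1 X]. *)
Lemma multiplier_exists n (rho sigma : 'M[C]_n) (L : R) :
  psd rho -> psd sigma -> supp_le rho sigma -> 0 < L ->
  exists M, [/\ psd M, psd (L%:C *: sigma - resol M *m rho *m resol M) &
    forall i, 0 < eigenv M i ->
      L * complex.Re ((spectralmx M *m sigma *m adj (spectralmx M)) i i) <=
      complex.Re ((spectralmx M *m rho *m adj (spectralmx M)) i i)].
Proof.
move=> pr ps supp L0.
have [Q [K [[hQ QQ sQ K0 pK] rQ]]] := support_projector ps.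
have {}rQ := rQ _ supp.
have [M [pM QMQ minM]] := objective_min_exists pr ps L0 K0 hQ QQ pK.
have eig := first_order_eigen pr hQ QQ pM QMQ minM.
suff : psd (L%:C *: sigma - resol M *m rho *m resol M) by exists M.
have upper := first_order_rank1 ps L0 hQ pM QMQ minM.
have QM : Q *m M = M by rewrite -QMQ !mulmxA QQ.
have MQ : M *m Q = M by rewrite -QMQ -!mulmxA QQ.
have Qs : Q *m sigma = sigma by rewrite -{1}hQ -{1}ps.1 -adjM sQ ps.1.
have Qr : Q *m rho = rho by rewrite -{1}hQ -{1}pr.1 -adjM rQ pr.1.
set T := resol M; have [hT _] : psd T := psd_resol pM.
have QT : Q *m T = T *m Q.
  have QM1 : Q *m (1%:M + M) = (1%:M + M) *m Q.
    by rewrite mulmxDr mulmxDl mul1mx mulmx1 QM MQ.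
  rewrite -[LHS]mul1mx -(resolmul pM) -/T -!mulmxA (mulmxA _ Q) -QM1.
  by rewrite -!mulmxA mulresol // mulmx1.
split=> [|v].
  by rewrite adjB adj_scale ps.1 !adjM hT pr.1 mulmxA.
rewrite mulmxBr mulmxBl -scalemxAr -scalemxAl.
(* Both [sigma] and [T rho T] are unchanged by compression with [Q], so [v] may be replaced by
   [Q v], to which [first_order_rank1] applies. *)
have QF (A : 'M[C]_n) : Q *m A *m Q = A -> adj v *m A *m v = adj (Q *m v) *m A *m (Q *m v).
  by move=> QA; rewrite adjM hQ -{1}QA !mulmxA.
have [Qv fT fs] : [/\ Q *m (Q *m v) = Q *m v,
    adj v *m (T *m rho *m T) *m v = adj (Q *m v) *m (T *m rho *m T) *m (Q *m v) &
    adj v *m sigma *m v = adj (Q *m v) *m sigma *m (Q *m v)].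
  split; first by rewrite mulmxA QQ.
  - apply: QF; rewrite !mulmxA QT -(mulmxA T Q) Qr -!mulmxA -QT.
    by rewrite (mulmxA rho) rQ.
  - by apply: QF; rewrite Qs sQ.
rewrite fT fs mxE [X in _ + X]mxE [X in X - _]mxE !form_tr subr_ge0.
have pW := psd_gram (Q *m v); have pTrT : psd (T *m rho *m T).
  by rewrite -{2}hT; apply: psd_cong.
rewrite (ge0_ReE (psd_trM_ge0 pTrT pW)) (ge0_ReE (psd_trM_ge0 ps pW)) -rmorphM lecR.
exact: upper _ Qv.
Qed.

End Minimizer.

(** * Purifications as matrices, and the trace distance of pure states *)

Section Purification.
Variable R : realType.
Local Notation C := R[i].

Definition ket_mx p q (v : 'cV[C]_(p * q)) : 'M[C]_(p, q) := vec_mx v^T.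
Definition mx_ket p q (A : 'M[C]_(p, q)) : 'cV[C]_(p * q) := (mxvec A)^T.

Lemma mx_ketK p q : cancel (@mx_ket p q) (@ket_mx p q).
Proof. by move=> A; rewrite /ket_mx trmxK mxvecK. Qed.

Lemma ptrace_ketbra p q (v : 'cV[C]_(p * q)) :
  ptrace (ketbra v) = ket_mx v *m adj (ket_mx v).
Proof.
apply/matrixP => i j; rewrite !mxE; apply: eq_bigr => k _.
by rewrite adjE !mxE big_ord1 adjE.
Qed.

Lemma ket_inner p q (u v : 'cV[C]_(p * q)) :
  adj u *m v = (\tr (ket_mx v *m adj (ket_mx u)))%:M.
Proof.
apply/matrixP => i j; rewrite !ord1 mxE mxE eqxx mulr1n /mxtrace.
rewrite (reindex _ (curry_mxvec_bij p q)) /=.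
transitivity (\sum_i \sum_j ket_mx v i j * adj (ket_mx u) j i).
  rewrite pair_bigA; apply: eq_bigr => -[k l] _ /=.
  by rewrite !adjE !mxE mulrC.
by apply: eq_bigr => k _; rewrite mxE.
Qed.

(** Since the partial trace preserves the trace, normalisation can be read off the reduced state. *)
Lemma unit_vecE p q (v : 'cV[C]_(p * q)) :
  unit_vec v <-> \tr (ptrace (ketbra v)) = 1.
Proof.
rewrite ptrace_ketbra /unit_vec ket_inner; split=> [|-> //].
by move=> /matrixP /(_ 0 0); rewrite !mxE !eqxx !mulr1n.
Qed.

Lemma ptraceD p q (A B : 'M[C]_(p * q)) : ptrace (A + B) = ptrace A + ptrace B.
Proof.
by apply/matrixP => i j; rewrite !mxE -big_split; apply: eq_bigr => k _; rewrite mxE.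
Qed.

Lemma ptraceZ p q (a : C) (A : 'M[C]_(p * q)) : ptrace (a *: A) = a *: ptrace A.
Proof.
by apply/matrixP => i j; rewrite !mxE mulr_sumr; apply: eq_bigr => k _; rewrite mxE.
Qed.

(** The two flags are orthogonal, so tracing out the qubit removes the cross terms. *)
Lemma ptrace_flag d (phi theta : 'cV[C]_d) (x y : R) :
  ptrace (ketbra (x%:C *: kron phi ket1 + y%:C *: kron theta ket0)) =
  (x ^+ 2)%:C *: ketbra phi + (y ^+ 2)%:C *: ketbra theta.
Proof.
have kronE (u : 'cV[C]_d) (e : 'cV[C]_2) i k :
    kron u e (mxvec_index i k) 0 = u i 0 * e k 0.
  by rewrite mxE mxvecE mxE big_ord1 mxE.
set z := (_ + _).
have zE i k : z (mxvec_index i k) 0 =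
    x%:C * (phi i 0 * ket1 k 0) + y%:C * (theta i 0 * ket0 k 0).
  by rewrite /z mxE [X in X + _]mxE [X in _ + X]mxE !kronE.
have z0 i : z (mxvec_index i 0) 0 = y%:C * theta i 0.
  by rewrite zE /ket0 /ket1 !mxE /= mulr0 mulr0 add0r mulr1.
have z1 i : z (mxvec_index i 1) 0 = x%:C * phi i 0.
  by rewrite zE /ket0 /ket1 !mxE /= !mulr0 addr0 mulr1.
apply/matrixP => i j; rewrite mxE !big_ord_recl big_ord0 addr0 /ketbra.
have bra k l : (z *m adj z) k l = z k 0 * conjc (z l 0).
  by rewrite mxE big_ord1 adjE.
rewrite !bra (_ : lift ord0 ord0 = 1) ?z0 ?z1; last exact: val_inj.
have conjM (a : R) (w : C) : conjc (a%:C * w) = a%:C * conjc w.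
  by rewrite rmorphM /= oppr0.
by rewrite !mxE !big_ord1 !adjE !conjM !expr2 !rmorphM; ring.
Qed.

(** Factor [tau = F F^*] and pad [F] with [m - n] zero columns, which leaves the product
    unchanged. *)
Lemma purification_exists n m (tau : 'M[C]_n) : (n <= m)%N -> psd tau ->
  exists theta : 'cV[C]_(n * m), ptrace (ketbra theta) = tau.
Proof.
move=> nm /psd_factor[F ->]; exists (mx_ket (F *m pid_mx n)).
rewrite ptrace_ketbra mx_ketK adjM mulmxA -[_ *m adj (pid_mx n)]mulmxA.
by rewrite /adj tr_pid_mx map_pid_mx pid_mx_id // pid_mx_1 mulmx1.
Qed.

Lemma sqrtC_real (x : R) : 0 <= x -> sqrtC x%:C = (Num.sqrt x)%:C.
Proof.
by move=> x0; rewrite -{1}(sqr_sqrtr x0) rmorphXn sqrCK // lecR sqrtr_ge0.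
Qed.

(* [D = uu^* - vv^*] satisfies [D^3 = c D] with [c = 1 - s^2], so [D^2] has
   spectrum in [{0, c}] and trace [2 c]. *)
Lemma trnorm_ketbra_le d (u v : 'cV[C]_d) (s : R) :
  unit_vec u -> unit_vec v -> adj u *m v = s%:C%:M ->
  trnorm (ketbra u - ketbra v) <= 2 * Num.sqrt (1 - s ^+ 2).
Proof.
rewrite /unit_vec => uu vv uv; set c := 1 - s ^+ 2.
have vu : adj v *m u = s%:C%:M.
  rewrite -[LHS]adjK adjM adjK uv; apply/matrixP => i j.
  by rewrite adjE !mxE !ord1 eqxx !mulr1n conjc_real.
set D := ketbra u - ketbra v.
have Du : D *m u = u - s%:C *: v.
  by rewrite mulmxBl -!mulmxA uu vu mulmx1 mul_mx_scalar.
have Dv : D *m v = s%:C *: u - v.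
  by rewrite mulmxBl -!mulmxA vv uv mulmx1 mul_mx_scalar.
have cE : c%:C = 1 - s%:C * s%:C by rewrite /c expr2 rmorphB rmorphM.
have DDu : D *m (D *m u) = c%:C *: u.
  rewrite Du mulmxBr -scalemxAr Du Dv scalerBr scalerA cE scalerBl scale1r.
  by rewrite opprB addrA subrK.
have DDv : D *m (D *m v) = c%:C *: v.
  rewrite Dv mulmxBr -scalemxAr Du Dv scalerBr scalerA cE scalerBl scale1r.
  by rewrite opprB [LHS]addrC addrA subrK.
have DDD : D *m D *m D = c%:C *: D.
  rewrite {3}/D mulmxBr /ketbra !mulmxA -(mulmxA D D u) -(mulmxA D D v) DDu DDv.
  by rewrite -!scalemxAl -scalerBr.
have EE : (D *m D) *m (D *m D) = c%:C *: (D *m D).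
  by rewrite mulmxA DDD -scalemxAl.
have hD : adj D = D by rewrite /D /ketbra adjB !adjM !adjK.
have pE : psd (D *m D) by rewrite -{2}hD; apply: psd_gram.
have trE : \tr (D *m D) = (2 * c)%:C.
  have -> : D *m D = (u - s%:C *: v) *m adj u - (s%:C *: u - v) *m adj v.
    by rewrite -Du -Dv -!mulmxA -mulmxBr.
  rewrite !mulmxBl !raddfB /=.
  have tr1 (x y : 'cV[C]_d) (z : C) : adj x *m y = z%:M -> \tr (y *m adj x) = z.
    by move=> xy; rewrite mxtrace_mulC xy mxtrace_scalar mulr1n.
  rewrite -!scalemxAl !mxtraceZ (tr1 _ _ _ uu) (tr1 _ _ _ vv) (tr1 _ _ _ uv) (tr1 _ _ _ vu).
  have -> : (2 * c)%:C = 2 * c%:C by rewrite rmorphM rmorph_nat.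
  by rewrite cE; ring.
set dd := eigenv (D *m D); have uU := spectralmx_unitary (D *m D).
have d0 i : 0 <= dd i by apply: eigenv_ge0.
have EU : D *m D = spec (spectralmx (D *m D)) dd := (hermitian_spectral pE.1).1.
have dE : (fun i => dd i * dd i) =1 (fun i => c * dd i).
  by apply: (spec_inj uU); rewrite -(specM _ _ uU) -specZ -EU.
have dsum : \sum_i dd i = 2 * c.
  by apply: (@complexI R); rewrite -trE -tr_eigenv // pE.1.
have c0 : 0 <= c by rewrite -(pmulr_rge0 _ (ltr0Sn R 1)) -dsum sumr_ge0.
have -> : trnorm D = \sum_i Num.sqrt (dd i).
  rewrite /trnorm /sqrtm (@mxfun_spec _ _ _ (@Num.sqrt R)).
  - by rewrite tr_spec.
  - exact: pE.1.
  - by move=> i; apply: sqrtC_real.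
(* Each [dd i] is 0 or [c], so [sqrt c] times the trace norm equals [Tr D^2 = 2 c]. The case
   [c = 0], where one cannot divide by [sqrt c], is treated apart. *)
have dc i : Num.sqrt c * Num.sqrt (dd i) = dd i.
  have [->|di] := eqVneq (dd i) 0; first by rewrite sqrtr0 mulr0.
  by rewrite -(mulIf di (dE i)) -expr2 sqr_sqrtr.
have [c00|cn0] := eqVneq c 0.
  rewrite big1 ?mulr_ge0 ?sqrtr_ge0 // => i _.
  by rewrite -(dc i) c00 sqrtr0 mul0r sqrtr0.
have sc : 0 < Num.sqrt c by rewrite sqrtr_gt0 lt_def cn0.
rewrite -(ler_pM2l sc) mulr_sumr (eq_bigr _ (fun i _ => dc i)) dsum.
by rewrite mulrCA -expr2 sqr_sqrtr.
Qed.

End Purification.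

(** * Construction of the substate *)

Section Substate.
Variable R : realType.
Local Notation C := R[i].

Lemma log2_powR2 (x : R) : log2 (powR 2 x) = x.
Proof. by rewrite /log2 ln_powR mulfK // gt_eqF ?ln2_gt0. Qed.

(** The witness is [B = T X] with [T = (1 + M)^-1], so that [f = Tr T rho] and [b = Tr T^2 rho]. The
    eigenvalues of [T] lie in [[0, 1]], whence [b <= f]; they equal 1 on the kernel of [M], whence
    [b >= 1 - p]. *)
Lemma substate_mx n m (rho sigma : 'M[C]_n) (X : 'M[C]_(n, m)) (k' r : R) :
  density rho -> density sigma -> supp_le rho sigma -> X *m adj X = rho ->
  1 < r -> 0 < k' -> relent rho sigma + 5 <= k' ->
  exists (B : 'M[C]_(n, m)) (f b : R),
    [/\ psd ((powR 2 (r * k'))%:C *: sigma - B *m adj B),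
        \tr (B *m adj X) = f%:C, \tr (B *m adj B) = b%:C & 1 - r^-1 <= b <= f].
Proof.
move=> dr ds supp XX r1 k0 kk.
have [hr pr0 tr] := dr; have [hs ps0 ts] := ds.
have pr : psd rho := conj hr pr0; have ps : psd sigma := conj hs ps0.
have r0 : 0 < r := lt_trans ltr01 r1.
set L := powR 2 (r * k').
have L0 : 0 < L by apply: powR_gt0.
have [M [pM pL eig]] := multiplier_exists pr ps supp L0.
have uU := spectralmx_unitary M.
set U := spectralmx M in uU eig; set d := eigenv M in eig.
have d0 i : 0 <= d i := eigenv_ge0 i pM.
pose rh i := complex.Re ((U *m rho *m adj U) i i).
pose si i := complex.Re ((U *m sigma *m adj U) i i).
have trU (A : 'M[C]_n) (g : 'I_n -> R) : psd A -> \tr (spec U g *m A) =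
    (\sum_i g i * complex.Re ((U *m A *m adj U) i i))%:C.
  move=> pA; rewrite tr_specM rmorph_sum; apply: eq_bigr => i _ /=.
  by rewrite rmorphM /= -(ge0_ReE (psd_diag_ge0 i (psd_cong U pA))).
have rh0 i : 0 <= rh i by apply: Re_ge0; apply: psd_diag_ge0; apply: psd_cong.
have rh1 : \sum_i rh i = 1.
  apply: (@complexI R); transitivity (\tr rho); last exact: tr.
  rewrite -[rho in RHS]mul1mx -(spec1 uU) (trU _ _ pr).
  by congr _%:C; apply: eq_bigr => i _; rewrite mul1r.
(* Indicator of the nonzero eigenvalues of [M]; the resulting [P] is the test fed to
   [tail_prob_le]. *)
pose bad i : R := (0 < d i)%R%:R.
pose P := spec U bad.
have badM i : bad i * bad i = bad i by rewrite /bad; case: (0 < d i)%R; rewrite ?mulr1 ?mulr0.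
pose p := \sum_i bad i * rh i.
pose q := \sum_i bad i * si i.
have p0 : 0 <= p by apply: sumr_ge0 => i _; rewrite mulr_ge0 ?ler0n.
have p1 : p <= 1.
  by rewrite -rh1; apply: ler_sum => i _; rewrite ler_piMl // /bad lern1 leq_b1.
have Lqp : L * q <= p.
  rewrite mulr_sumr; apply: ler_sum => i _; rewrite mulrCA /bad.
  by have := eig i; case: (0 < d i)%R => [/(_ isT) h|_]; rewrite ?mul1r ?mul0r.
have L1 : 1 <= L.
  by rewrite -(powRr0 2) /L; apply: ler_powR; rewrite ?ler1n // mulr_ge0 ?ltW.
have hP : adj P = P := adj_spec _ _.
have PP : P *m P = P by rewrite (specM _ _ uU); apply: eq_spec.
have := tail_prob_le dr ds supp hP PP (trU _ _ pr) (trU _ _ ps) _ L1 Lqp.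
rewrite -/p p0 p1 /L log2_powR2 => /(_ isT) /le_trans /(_ kk) tail.
(* As [log2 L = r k'], the entropy bound reads [p r k' <= k'], and the positive [k'] cancels. *)
have pr1 : p <= r^-1.
  by rewrite -(ler_pM2r k0) -(ler_pM2l r0) !mulrA mulfV ?gt_eqF // mul1r -mulrA mulrCA.
pose t i := (1 + d i)^-1.
have TE : resol M = spec U t := (resol_spec pM).2.
have hT : adj (spec U t) = spec U t := adj_spec _ _.
have d1 i : 0 < 1 + d i by rewrite ltr_pwDl.
have t0 i : 0 <= t i by rewrite invr_ge0 ltW.
have t1 i : t i <= 1 by rewrite invf_le1 // lerDl.
have BB : (spec U t *m X) *m adj (spec U t *m X) = spec U t *m rho *m spec U t.
  by rewrite adjM hT mulmxA -(mulmxA (spec U t)) XX.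
exists (spec U t *m X), (\sum_i t i * rh i), (\sum_i (t i * t i) * rh i); split.
- by rewrite BB -TE.
- by rewrite -mulmxA XX (trU _ _ pr).
- by rewrite BB mxtrace_mulC mulmxA (specM _ _ uU) (trU _ _ pr).
apply/andP; split; last first.
  by apply: ler_sum => i _; rewrite ler_wpM2r // ler_piMl.
apply: le_trans (_ : 1 - p <= _); first by rewrite lerD2l lerN2.
rewrite -rh1 -sumrB; apply: ler_sum => i _.
rewrite /bad; have := d0 i; rewrite le_eqVlt => /predU1P[di|di].
  by rewrite -di ltxx mul0r subr0 /t -di addr0 invr1 !mul1r.
by rewrite di mul1r subrr !mulr_ge0.
Qed.

End Substate.

Theorem theorem2 (R : realType) (n m : nat) (hnm : (n <= m)%N)
  (rho sigma : 'M[R[i]]_n) (r : R)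
  (hrho : density rho) (hsigma : density sigma) (hr : 1 < r)
  (hsupp : supp_le rho sigma)
  (psi : 'cV[R[i]]_(n * m))
  (hpsi : unit_vec psi) (hpur : ptrace (ketbra psi) = rho) :
  let k := relent rho sigma in
  let k' := k + 4 * Num.sqrt (k + 2) + 2 * log2 (k + 2) + 5 in
  let a := (r - 1) / (r * powR 2 (r * k')) in
  exists (phi theta : 'cV[R[i]]_(n * m)) (zeta : 'cV[R[i]]_(n * m * 2)),
    [/\ unit_vec phi /\ unit_vec theta, unit_vec zeta,
        ptrace (ptrace (ketbra zeta)) = sigma,
        trnorm (ketbra psi - ketbra phi) <= 2 / Num.sqrt r
      & zeta = (Num.sqrt a)%:C *: kron phi ket1
               + (Num.sqrt (1 - a))%:C *: kron theta ket0].
Proof.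
move=> k k' a.
have k0 : 0 <= k by apply: relent_ge0.
have kk' : k + 5 <= k'.
  have l0 : 0 <= log2 (k + 2).
    by apply: log2_ge0; apply: ler_wpDl k0 _; rewrite (ler1n R 2).
  rewrite /k' lerD2r -addrA lerDl.
  by apply: addr_ge0; apply: mulr_ge0; rewrite ?ler0n ?sqrtr_ge0 ?l0.
have k'0 : 0 < k' by rewrite (lt_le_trans _ kk') // ltr_wpDl.
have r0 : 0 < r := lt_trans ltr01 hr.
have XX := hpur; rewrite ptrace_ketbra in XX.
have [B [f [b [pL trf trb /andP[b1 bf]]]]] :=
  substate_mx hrho hsigma hsupp XX hr k'0 kk'.
pose L := powR 2 (r * k'); rewrite -/L in pL.
have L1 : 1 <= L.
  by rewrite -(powRr0 2) /L; apply: ler_powR; rewrite ?ler1n // mulr_ge0 ?ltW.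
have L0 : 0 < L := lt_le_trans ltr01 L1.
have ri1 : r^-1 < 1 by rewrite invf_lt1.
(* The weight [a] is calibrated so that [a L] equals the guaranteed lower bound on [b]. *)
have aL : a * L = 1 - r^-1 by rewrite /a -/L; field; rewrite !gt_eqF.
have b0 : 0 < b by rewrite (lt_le_trans _ b1) // subr_gt0.
have a0 : 0 <= a by rewrite /a -/L divr_ge0 ?mulr_ge0 ?subr_ge0 ?ltW.
clearbody a; clearbody L.
have a1 : a < 1.
  apply: le_lt_trans (_ : a * L < 1); first by rewrite ler_peMr.
  by rewrite aL gtrBl invr_gt0.
have [hs ps0 ts] := hsigma; have ps : psd sigma := conj hs ps0.
pose phi := mx_ket (((Num.sqrt b)^-1)%:C *: B).
have sb2 : (Num.sqrt b)^-1 * (Num.sqrt b)^-1 = b^-1.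
  by rewrite -invfM -expr2 sqr_sqrtr // ltW.
have phiE : ptrace (ketbra phi) = (b^-1)%:C *: (B *m adj B).
  by rewrite ptrace_ketbra mx_ketK adj_scale -scalemxAr -scalemxAl scalerA -rmorphM sb2.
have uphi : unit_vec phi.
  by apply/unit_vecE; rewrite phiE mxtraceZ trb -rmorphM mulVf ?gt_eqF.
(* What remains of [sigma] once [a] times the reduced state of [phi] is removed, rescaled to trace
   1; [theta] will purify it. *)
pose tau := ((1 - a)^-1)%:C *: (sigma - a%:C *: ((b^-1)%:C *: (B *m adj B))).
have ptau : psd tau.
  apply: psdZ; first by rewrite invr_ge0 subr_ge0 ltW.
  (* A combination of the positive matrices [L sigma - B B^*] and [sigma]; the second coefficient is
     nonnegative because [a L = 1 - 1 / r <= b]. *)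
  have -> : sigma - a%:C *: ((b^-1)%:C *: (B *m adj B)) =
    (a / b)%:C *: (L%:C *: sigma - B *m adj B) + (1 - a * L / b)%:C *: sigma.
    rewrite scalerBr !scalerA -!rmorphM rmorphB scalerBl scale1r.
    rewrite [a / b * L]mulrAC [RHS]addrC -addrA; congr (_ + _).
    by rewrite addrA addNr sub0r.
  apply: psdD; apply: psdZ => //; first by rewrite divr_ge0 // ltW.
  by rewrite subr_ge0 ler_pdivrMr // mul1r aL.
have [theta thetaE] := purification_exists hnm ptau.
have utheta : unit_vec theta.
  apply/unit_vecE; rewrite thetaE /tau mxtraceZ raddfB /= !mxtraceZ trb ts.
  by rewrite -rmorphM mulVf ?gt_eqF // mulr1 -rmorphB -rmorphM mulVf // gt_eqF // subr_gt0.
set zeta := (Num.sqrt a)%:C *: kron phi ket1 + (Num.sqrt (1 - a))%:C *: kron theta ket0.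
have zE : ptrace (ketbra zeta) = a%:C *: ketbra phi + (1 - a)%:C *: ketbra theta.
  by rewrite ptrace_flag !sqr_sqrtr // subr_ge0 ltW.
exists phi, theta, zeta; split=> //.
- apply/unit_vecE; rewrite zE mxtraceD !mxtraceZ.
  have tr1 (v : 'cV[R[i]]_(n * m)) : unit_vec v -> \tr (ketbra v) = 1.
    by move=> uv; rewrite mxtrace_mulC uv mxtrace1.
  by rewrite !tr1 // !mulr1 -rmorphD addrC subrK.
- rewrite zE ptraceD !ptraceZ phiE thetaE /tau.
  rewrite [(1 - a)%:C *: _]scalerA -rmorphM mulfV ?scale1r; last first.
    by rewrite gt_eqF // subr_gt0.
  by rewrite addrC subrK.
(* Overlap of [psi] with the normalised [phi]: [s^2 = f^2 / b >= b >= 1 - 1 / r], so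
   [2 sqrt (1 - s^2) <= 2 / sqrt r]. *)
pose s := f / Num.sqrt b.
have inner : adj psi *m phi = s%:C%:M.
  rewrite ket_inner mx_ketK -scalemxAl mxtraceZ trf -rmorphM.
  by congr (_%:C%:M); rewrite mulrC.
apply: le_trans (trnorm_ketbra_le hpsi uphi inner) _.
rewrite ler_pM2l // -(sqrtrV (ltW r0)); apply: ler_wsqrtr.
rewrite lerBlDr -lerBlDl; apply: le_trans b1 _.
rewrite /s expr_div_n (sqr_sqrtr (ltW b0)) (ler_pdivlMr _ _ b0) expr2.
by apply: (ler_pM _ _ bf bf); apply: ltW.
Qed.
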